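(* Let $p\ge1$, let $X:[0,1]\to G(V)$ be a geometric $p$-rough path and $U$ a Banach space. Suppose $\beta\in(X,E^U_X)$ is a slowly-varying one-form with $\|\beta\|_\theta^\omega<\infty$ for a control $\omega$ and $\theta>1$. Define $h:[0,1]\to U$ by $h_t:=\int_{r=0}^t\beta(X_r)\,dX_r$. Let $\hat\omega$ be the control $\hat\omega(s,t):=\omega(s,t)+\|X\|^p_{p-var,[s,t]}$. Then there is a constant $C=C_{p,\theta,\hat\omega(0,1)}$ depending only on $p,\theta,\hat\omega(0,1)$ such that $$\|h_t-h_s-\beta(X_s)(X_{s,t})\|\le C\,\|\beta\|_\theta^\omega\,\hat\omega(s,t)^\theta\quad\text{for all }0\le s\le t\le1,$$ and $$\|h\|_{p-var,[0,1]}\le C\,\|\beta\|_\theta^\omega .$$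
   Context: $V$ is a Banach space; tensor powers are completed under admissible norms (permutations of factors are isometries, $\|v\otimes w\|\le\|v\|\|w\|$). $T((V))=\prod_{n\ge0}V^{\otimes n}$, $x=\sum_k x^k$ with $x^k=\pi_k(x)\in V^{\otimes k}$. $G(V)$ is the group of group-like elements: $x^0=1$ and $x^n\otimes x^m=\sum_\tau\tau^{-1}\cdot x^{n+m}$ for all $n,m$, the sum over $\tau\in S_{n+m}$ that are shuffles (words $\tau(1)\cdots\tau(n+m)$ in which $1,\dots,n$ appear in increasing order and $n+1,\dots,n+m$ appear in increasing order), with $\sigma\cdot(v_1\otimes\cdots\otimes v_N)=v_{\sigma1}\otimes\cdots\otimes v_{\sigma N}$. $d(a,b):=\sup_{k\ge1}\|\pi_k(a^{-1}b)\|^{1/k}$ on $G(V)$. A control is a continuous super-additive function $\omega:\{(s,t):0\le s\le t\le1\}\to[0,\infty)$ vanishing on the diagonal. $X:[0,1]\to G(V)$ is a geometric $p$-rough path if $\|X\|^p_{p-var,[s,t]}:=\sup_D\sum_k d(X_{t_k},X_{t_{k+1}})^p$ (supremum over finite partitions of $[s,t]$) is bounded by $\omega(s,t)$ for some control $\omega$. $X_{s,t}:=X_s^{-1}X_t$. For $h:[0,1]\to U$, $\|h\|_{p-var,[0,1]}:=\sup_D(\sum_k\|h_{t_{k+1}}-h_{t_k}\|^p)^{1/p}$. $[p]$ is the integer part of $p$. For $a\in G(V)$, $E^U_a$ is the vector space of functions $\phi:G(V)\to U$ of the form $\phi(x)=\sum_{k=1}^{[p]}\phi^k(x^k)$ with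 $\phi^k\in L(V^{\otimes k},U)$ (continuous linear). $\|\phi\|_k:=\|\phi^k\|$ (operator norm), $\|\phi\|:=\max_{k}\|\phi\|_k$. For $b\in G(V)$, $(\phi)_b(x):=\phi(bx)-\phi(b)$, again of this form. $\beta\in(X,E^U_X)$ means $\beta$ assigns to each $t\in[0,1]$ an element $\beta(X_t)\in E^U_{X_t}$. For a control $\omega$ and $\theta>1$, $$\|\beta\|_\theta^\omega:=\sup_{t\in[0,1]}\|\beta(X_t)\|+\max_{k=1,\dots,[p]}\sup_{0\le s<t\le1}\frac{\|\beta(X_t)-(\beta(X_s))_{X_{s,t}}\|_k}{\omega(s,t)^{\theta-k/p}}$$ (with $0/0=0$). $\beta$ is slowly-varying if $\|\beta\|_\theta^\omega<\infty$ for some control $\omega$ and $\theta>1$. In that case, for $t\in[0,1]$, $\int_{r=0}^t\beta(X_r)\,dX_r:=\lim_{|D|\to0}\sum_k\beta(X_{t_k})(X_{t_k,t_{k+1}})$, the limit over finite partitions $D=\{t_k\}$ of $[0,t]$ with mesh $|D|\to 0$, which exists. *)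

(* Defs.v *)
From HB Require Import structures.
From mathcomp Require Import all_boot all_order all_algebra all_fingroup.
From mathcomp Require Import all_classical all_reals all_analysis.

Set Implicit Arguments.
Unset Strict Implicit.
Unset Printing Implicit Defensive.

Import Order.TTheory GRing.Theory Num.Theory.
Import numFieldNormedType.Exports.

Local Open Scope classical_set_scope.
Local Open Scope ring_scope.

Definition multilinear (R : realType) (V W : lmodType R) (n : nat)
    (f : ('I_n -> V) -> W) : Prop :=
  forall (v : 'I_n -> V) (i : 'I_n),
    linear (fun x => f (fun j => if j == i then x else v j)).

(* The completed tensor powers of V under admissible norms. [tpow n] is a
   Banach space in which the algebraic tensor power sits as the span of the
   pure tensors: [tpure_universal] says that this span has the universal
   property of the algebraic tensor power (the factorization g is only
   determined on the span; any algebraic linear extension to the completion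
   will do), and [tpure_dense] that [tpow n] is its completion.  The maps
   [tens] (tensor product) and [tperm_act] (permutation of factors) are
   determined by their values on pure tensors.  [norm_tpure0] and
   [norm_tpure1] identify the powers of order 0 and 1 with R and V
   isometrically. *)
Record tensor_powers (R : realType) (V : completeNormedModType R) :=
  TensorPowers {
  tpow : nat -> completeNormedModType R ;
  tpure : forall n, ('I_n -> V) -> tpow n ;
  tpure_multilinear : forall n, multilinear (@tpure n) ;
  tpure_universal :
    forall n (W : lmodType R) (f : ('I_n -> V) -> W), multilinear f ->
      exists g : {linear tpow n -> W}, forall v, g (tpure v) = f v ;
  tpure_dense :
    forall n, dense [set x : tpow n |
      exists (m : nat) (c : 'I_m -> R) (v : 'I_m -> 'I_n -> V),
        x = \sum_(i < m) c i *: tpure (v i)] ;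
  norm_tpure0 : forall v : 'I_0 -> V, `|tpure v| = 1 ;
  norm_tpure1 : forall v : 'I_1 -> V, `|tpure v| = `|v ord0| ;
  tens : forall n m, tpow n -> tpow m -> tpow (n + m) ;
  tens_linearl : forall n m (y : tpow m), linear (fun x : tpow n => tens x y) ;
  tens_linearr : forall n m (x : tpow n), linear (fun y : tpow m => tens x y) ;
  tens_pure :
    forall n m (v : 'I_n -> V) (w : 'I_m -> V),
      tens (tpure v) (tpure w) =
      tpure (fun i : 'I_(n + m) =>
               match fintype.split i with inl j => v j | inr k => w k end) ;
  tperm_act : forall n, 'S_n -> tpow n -> tpow n ;
  tperm_act_linear : forall n (s : 'S_n), linear (tperm_act s) ;
  tperm_act_pure :
    forall n (s : 'S_n) (v : 'I_n -> V),
      tperm_act s (tpure v) = tpure (fun i => v (s i)) ;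
  (* admissibility of the norms *)
  norm_tperm_act : forall n (s : 'S_n) (x : tpow n), `|tperm_act s x| = `|x| ;
  norm_tens :
    forall n m (x : tpow n) (y : tpow m), `|tens x y| <= `|x| * `|y|
}.

Section TensorSeries.
Context {R : realType} {V : completeNormedModType R} (T : tensor_powers V).

(* T((V)); the projection pi_n x is the application x n. *)
Definition tseries := forall n, tpow T n.

Definition ts_one : tseries := fun n =>
  match n return tpow T n with
  | 0%N => tpure T (fun _ => 0)
  | _.+1 => 0
  end.

Definition ts_mul (x y : tseries) : tseries := fun n =>
  \sum_(i < n.+1)
    ecast k (tpow T k) (subnKC (leq_ord i)) (tens (x i) (y (n - i)%N)).

(* Only used on series x with x 0 = 1, for which the inverse exists and is
   unique. *)
Definition ts_inv (x : tseries) : tseries :=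
  xget ts_one [set y | ts_mul x y = ts_one /\ ts_mul y x = ts_one].

(* In the word s(1) ... s(n+m) the position of the letter i is s^-1 i. *)
Definition is_shuffle (n m : nat) (s : 'S_(n + m)) : bool :=
  [forall i : 'I_n, forall j : 'I_n,
     (i < j)%N ==> ((s^-1)%g (lshift m i) < (s^-1)%g (lshift m j))%N] &&
  [forall i : 'I_m, forall j : 'I_m,
     (i < j)%N ==> ((s^-1)%g (rshift n i) < (s^-1)%g (rshift n j))%N].

(* G(V) *)
Definition group_like (x : tseries) : Prop :=
  x 0%N = ts_one 0%N /\
  forall n m, tens (x n) (x m) =
    \sum_(s : 'S_(n + m) | is_shuffle s) tperm_act (s^-1)%g (x (n + m)%N).

Definition gdist (a b : tseries) : \bar R :=
  ereal_sup [set (`|ts_mul (ts_inv a) b k| `^ k%:R^-1)%:E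
            | k in [set k : nat | (1 <= k)%N]].

(* X_{s,t} *)
Definition increment (X : R -> tseries) (s t : R) : tseries :=
  ts_mul (ts_inv (X s)) (X t).

End TensorSeries.

Definition is_control (R : realType) (w : R -> R -> R) : Prop :=
  [/\ {within [set st : R * R | 0 <= st.1 /\ st.1 <= st.2 /\ st.2 <= 1],
         continuous (fun st => w st.1 st.2)},
      forall s t : R, 0 <= s -> s <= t -> t <= 1 -> 0 <= w s t,
      forall t : R, 0 <= t -> t <= 1 -> w t t = 0 &
      forall s u t : R, 0 <= s -> s <= u -> u <= t -> t <= 1 ->
        w s u + w u t <= w s t].

(* A partition s = t_0 < ... < t_n = t of [s, t] is given by the list
   [:: t_1; ...; t_n], see [itv_partition]; its k-th interval is
   [pt s D k, pt s D k.+1]. *)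
Definition pt (R : realType) (s : R) (D : seq R) (k : nat) : R :=
  nth 0 (s :: D) k.

Definition mesh (R : realType) (s : R) (D : seq R) : R :=
  \big[Num.max/0]_(k < size D) (pt s D k.+1 - pt s D k).

Section RoughPath.
Context {R : realType} {V : completeNormedModType R} (T : tensor_powers V).

(* ||X||_{p-var,[s,t]}^p *)
Definition pvarp (p : R) (X : R -> tseries T) (s t : R) : \bar R :=
  ereal_sup
    [set (\sum_(k < size D) poweR (gdist (X (pt s D k)) (X (pt s D k.+1))) p)%E
    | D in [set D | itv_partition s t D]].

Definition geometric_rough_path (p : R) (X : R -> tseries T) : Prop :=
  (forall t : R, 0 <= t -> t <= 1 -> group_like (X t)) /\
  exists w : R -> R -> R, is_control w /\
    forall s t : R, 0 <= s -> s <= t -> t <= 1 -> (pvarp p X s t <= (w s t)%:E)%E.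

End RoughPath.

(* ||h||_{p-var,[s,t]} *)
Definition pvar (R : realType) (U : completeNormedModType R) (p : R)
    (h : R -> U) (s t : R) : \bar R :=
  ereal_sup
    [set ((\sum_(k < size D) `|h (pt s D k.+1) - h (pt s D k)| `^ p)
            `^ p^-1)%:E
    | D in [set D | itv_partition s t D]].

Definition opnorm (R : realType) (V W : normedModType R) (f : V -> W) : R :=
  sup [set `|f v| | v in [set v | `|v| <= 1]].

Section OneForms.
Context {R : realType} {V : completeNormedModType R} (T : tensor_powers V)
        {U : completeNormedModType R} (p : R).

(* A function phi : G(V) -> U is represented by a function on T((V)) whose
   values outside G(V) are irrelevant.  [represents c phi] says that
   phi(x) = sum_{1 <= k <= [p]} c_k(x^k) on G(V), the c_k being continuous
   linear. *)
Definition represents (c : forall k, {linear tpow T k -> U})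
    (phi : tseries T -> U) : Prop :=
  (forall k, continuous (c k)) /\
  forall x, group_like x ->
    phi x = \sum_(1 <= k < (Num.truncn p).+1) c k (x k).

(* The space E^U_a, which as a vector space does not depend on a. *)
Definition one_form (phi : tseries T -> U) : Prop :=
  exists c, represents c phi.

(* The coefficients phi^k, 1 <= k <= [p], of a one-form phi. They are uniquely
   determined by phi on G(V): products of exponentials of elements of V are
   group-like, and by multilinearity and scaling the components of degree k of
   such products have a dense span in [tpow T k], independently in each
   degree. *)
Definition form_coef (phi : tseries T -> U) : forall k, {linear tpow T k -> U} :=
  xget (fun k => \0 : {linear tpow T k -> U}) [set c | represents c phi].

Definition form_normk (k : nat) (phi : tseries T -> U) : R :=
  opnorm (form_coef phi k).

Definition form_norm (phi : tseries T -> U) : R :=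
  \big[Num.max/0]_(1 <= k < (Num.truncn p).+1) form_normk k phi.

(* (phi)_b *)
Definition form_shift (b : tseries T) (phi : tseries T -> U) : tseries T -> U :=
  fun x => phi (ts_mul b x) - phi b.

(* beta in (X, E^U_X); beta t stands for beta(X_t), whence the absence of X. *)
Definition one_form_along (beta : R -> tseries T -> U) : Prop :=
  forall t : R, 0 <= t -> t <= 1 -> one_form (beta t).

(* ||beta||_theta^w. In \bar R one has 0 / 0 = 0, and c / 0 = +oo if c > 0. *)
Definition slow_norm (theta : R) (w : R -> R -> R) (X : R -> tseries T)
    (beta : R -> tseries T -> U) : \bar R :=
  (ereal_sup [set (form_norm (beta t))%:E | t in [set t | (0 <= t <= 1)%R]] +
   \big[maxe/0]_(1 <= k < (Num.truncn p).+1)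
     ereal_sup
       [set (form_normk k
               (beta st.2 \- form_shift (increment X st.1 st.2) (beta st.1)))%:E
            / (w st.1 st.2 `^ (theta - k%:R / p))%:E
       | st in [set st : R * R | (0 <= st.1)%R /\ (st.1 < st.2)%R /\
                                 (st.2 <= 1)%R]])%E.

Definition riemann_sum (X : R -> tseries T) (beta : R -> tseries T -> U)
    (D : seq R) : U :=
  \sum_(k < size D) beta (pt 0 D k) (increment X (pt 0 D k) (pt 0 D k.+1)).

(* The filter of partitions of [0, t] with mesh tending to 0. *)
Definition mesh_to0 (t : R) : set_system (seq R) :=
  filter_from [set d : R | 0 < d]
    (fun d => [set D | itv_partition 0 t D /\ mesh 0 D < d]).

(* \int_{r=0}^t beta(X_r) dX_r *)
Definition rough_integral (X : R -> tseries T) (beta : R -> tseries T -> U)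
    (t : R) : U :=
  lim (riemann_sum X beta @ mesh_to0 t).

End OneForms.

(* Main.v *)
Require Import Defs.
From HB Require Import structures.
From mathcomp Require Import all_boot all_order all_algebra all_fingroup.
From mathcomp Require Import all_classical all_reals all_analysis.
From mathcomp Require Import zify ring lra.
Import Order.TTheory GRing.Theory Num.Theory.
Import numFieldNormedType.Exports.
Local Open Scope classical_set_scope.
Local Open Scope ring_scope.

(** Write mu(s,t) = beta(X_s)(X_{s,t}), N = ||beta|| and W = w + ||X||^p.  Since
    X_{s,u} X_{u,t} = X_{s,t}, the defect mu(s,t) - mu(s,u) - mu(u,t) is minus
    the one-form beta(X_u) - (beta(X_s))_{X_{s,u}} evaluated at X_{u,t}.  Its k-th
    coefficient is at most N w(s,u)^(theta-k/p) and |X_{u,t}^k| <= W(u,t)^(k/p),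
    so the defect is at most [p] N W(s,t)^theta.  W is superadditive, hence
    Young's sewing argument bounds mu(s,t) - (Riemann sum over [s,t]) by a
    multiple of W(s,t)^theta, uniformly in the partition; this gives both the
    convergence of the Riemann sums and the first estimate.  The second one
    follows from |mu(s,t)| <= N sum_k W(s,t)^(k/p).

    One-forms are only controlled on group-like elements, so one needs that
    G(V) is a group.  The identity x^n (x) x^m = unshuffle_{n,m}(x^{n+m}) is
    multiplicative: both sides for x y are the same sum of products of the
    corresponding terms for x and y, up to a permutation of the two middle
    blocks of letters.  The same expansion of x x^{-1} = 1 yields the identity
    for x^{-1} by induction on n + m. *)

Set Implicit Arguments.
Unset Strict Implicit.

(** * Bounded linear maps and pure tensors *)

Section BoundedLinear.
Context {R : realType}.

Definition bounded_linear (W1 W2 : normedModType R) (f : W1 -> W2) :=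
  linear f /\ exists C : R, forall x, `|f x| <= C * `|x|.

Lemma bounded_linearB (W1 W2 : normedModType R) (f : W1 -> W2) x y :
  bounded_linear f -> f (x - y) = f x - f y.
Proof. by case=> fl _; rewrite addrC -scaleN1r fl scaleN1r addrC. Qed.

Lemma bounded_linear0 (W1 W2 : normedModType R) (f : W1 -> W2) :
  bounded_linear f -> f 0 = 0.
Proof. by move=> fb; rewrite -(subrr 0) (bounded_linearB _ _ fb) subrr. Qed.

Lemma bounded_linearD (W1 W2 : normedModType R) (f : W1 -> W2) x y :
  bounded_linear f -> f (x + y) = f x + f y.
Proof. by case=> fl _; rewrite -{1}[x]scale1r fl scale1r. Qed.

Lemma bounded_linearZ (W1 W2 : normedModType R) (f : W1 -> W2) a x :
  bounded_linear f -> f (a *: x) = a *: f x.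
Proof.
by move=> fb; rewrite -[a *: x]addr0 (proj1 fb) (bounded_linear0 fb) !addr0.
Qed.

Lemma bounded_linear_sum (W1 W2 : normedModType R) (f : W1 -> W2)
    (I : Type) (r : seq I) (P : pred I) (F : I -> W1) :
  bounded_linear f ->
  f (\sum_(i <- r | P i) F i) = \sum_(i <- r | P i) f (F i).
Proof.
move=> fb; apply: (big_morph f) => [x y|]; first exact: bounded_linearD.
exact: bounded_linear0.
Qed.

Lemma bounded_linear_id (W : normedModType R) : bounded_linear (@id W).
Proof. by split=> //; exists 1 => x; rewrite mul1r. Qed.

Lemma bounded_linear_cst0 (W1 W2 : normedModType R) :
  bounded_linear (fun _ : W1 => 0 : W2).
Proof.
split; first by move=> a x y; rewrite scaler0 addr0.
by exists 0 => x; rewrite normr0 mul0r.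
Qed.

Lemma bounded_linear_comp (W1 W2 W3 : normedModType R)
    (g : W2 -> W3) (f : W1 -> W2) :
  bounded_linear g -> bounded_linear f -> bounded_linear (fun x => g (f x)).
Proof.
move=> [gl [C gC]] [fl [D fD]]; split=> [a x y|]; first by rewrite fl gl.
exists (`|C| * D) => x; apply: (le_trans (gC _)).
rewrite -mulrA; apply: (@le_trans _ _ (`|C| * `|f x|)).
  by rewrite ler_wpM2r// ler_norm.
by rewrite ler_wpM2l.
Qed.

Lemma bounded_linear_add (W1 W2 : normedModType R) (f g : W1 -> W2) :
  bounded_linear f -> bounded_linear g -> bounded_linear (fun x => f x + g x).
Proof.
move=> [gl [C gC]] [fl [D fD]]; split=> [a x y|].
  by rewrite fl gl scalerDr addrACA.
exists (C + D) => x; rewrite mulrDl (le_trans (ler_normD _ _))//.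
exact: lerD.
Qed.

Lemma bounded_linear_sub (W1 W2 : normedModType R) (f g : W1 -> W2) :
  bounded_linear f -> bounded_linear g -> bounded_linear (fun x => f x - g x).
Proof.
move=> [fl [C gC]] [gl [D fD]]; split=> [a x y|].
  by rewrite fl gl scalerBr opprD addrACA.
exists (C + D) => x; rewrite mulrDl (le_trans (ler_normB _ _))//.
exact: lerD.
Qed.

Lemma bounded_linear_big (W1 W2 : normedModType R)
    (I : Type) (r : seq I) (P : pred I) (F : I -> W1 -> W2) :
  (forall i, bounded_linear (F i)) ->
  bounded_linear (fun x => \sum_(i <- r | P i) F i x).
Proof.
move=> Fb; elim: r => [|i r IH].
  have -> : (fun x => \sum_(i <- [::] | P i) F i x) = fun _ : W1 => 0.
    by apply/funext => x; rewrite big_nil.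
  exact: bounded_linear_cst0.
case Pi : (P i).
- have -> : (fun x => \sum_(j <- i :: r | P j) F j x) =
            fun x => F i x + \sum_(j <- r | P j) F j x.
    by apply/funext => x; rewrite big_cons Pi.
  exact: bounded_linear_add.
- have -> // : (fun x => \sum_(j <- i :: r | P j) F j x) =
            fun x => \sum_(j <- r | P j) F j x.
  by apply/funext => x; rewrite big_cons Pi.
Qed.

Lemma continuous_of_bounded_linear (W1 W2 : normedModType R) (f : W1 -> W2) :
  bounded_linear f -> continuous f.
Proof.
move=> fb x; have [_ [C fC]] := fb.
apply/cvgrPdist_lt => e e0.
have C0 : 0 < `|C| + 1 by rewrite ltr_pwDr.
near=> y; rewrite -(bounded_linearB _ _ fb).
apply: (@le_lt_trans _ _ ((`|C| + 1) * `|x - y|)).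
  rewrite (le_trans (fC _))// ler_wpM2r// (le_trans (ler_norm _))//.
  by rewrite lerDl.
rewrite mulrC -ltr_pdivlMr//.
near: y; apply: cvgr_dist_lt; last by rewrite divr_gt0.
exact: cvg_id.
Unshelve. all: by end_near. Qed.

End BoundedLinear.

(** * Words of letters and the tensor product read in a prescribed degree *)

Section TensorWords.
Context {R : realType} {V : completeNormedModType R} (T : tensor_powers V).

(** Pure tensors are encoded by lists so that tensor products and permutations become list
    operations. The degree [n] is kept apart from [size s], which avoids casts; missing letters
    default to 0. *)
Definition word (n : nat) (s : seq V) : tpow T n :=
  tpure T (fun i : 'I_n => nth 0 s i).

Lemma tpure_word n (v : 'I_n -> V) :
  tpure T v = word n [seq v i | i <- enum 'I_n].
Proof.
congr tpure; apply/funext => i.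
by rewrite (nth_map i) ?size_enum_ord// nth_ord_enum.
Qed.

(** Pure tensors span a dense subspace and [f - g] is bounded. All identities between tensor
    operations below are reduced to words this way, one factor at a time. *)
Lemma bounded_linear_ext n (W : normedModType R) (f g : tpow T n -> W) :
  bounded_linear f -> bounded_linear g ->
  (forall s, size s = n -> f (word n s) = g (word n s)) -> f =1 g.
Proof.
move=> fb gb fg x.
have [_ [C hC]] := bounded_linear_sub fb gb.
apply/subr0_eq/eqP; rewrite -normr_eq0 eq_le normr_ge0 andbT.
apply/ler_addgt0Pr => e e0; rewrite add0r.
have C0 : 0 < `|C| + 1 by rewrite ltr_pwDr.
(* A combination [y] of pure tensors this close to [x] gives [|f x - g x| <= e], as [f - g] vanishes
   at [y]; the [+ 1] keeps the divisor positive. *)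
have [|y [xy [m [c [v yE]]]]] :=
    @tpure_dense _ _ T n (ball x (e / (`|C| + 1))) _ (ball_open _ _).
  by exists x; apply: ballxx; rewrite divr_gt0.
have fgy : f y - g y = 0.
  rewrite yE !(bounded_linear_sum _ _ _ fb, bounded_linear_sum _ _ _ gb).
  rewrite -sumrB big1// => i _.
  rewrite !(bounded_linearZ _ _ fb, bounded_linearZ _ _ gb).
  by rewrite tpure_word fg ?subrr// size_map size_enum_ord.
rewrite -[_ - _]subr0 -fgy.
rewrite -(bounded_linearB x y (bounded_linear_sub fb gb)).
rewrite (le_trans (hC _))//.
apply: (@le_trans _ _ ((`|C| + 1) * `|x - y|)).
  by rewrite ler_wpM2r// (le_trans (ler_norm _))// lerDl.
move: xy; rewrite -ball_normE /= => xy.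
by rewrite mulrC -ler_pdivlMr// ltW.
Qed.

(* Transport along k = N; 0 if the degrees differ. *)
Definition to_degree N k (a : tpow T k) : tpow T N :=
  match @eqP _ k N with
  | ReflectT e => ecast n (tpow T n) e a
  | ReflectF _ => 0
  end.

Lemma to_degree_id N (a : tpow T N) : to_degree N a = a.
Proof. by rewrite /to_degree; case: eqP => // e; rewrite (eq_axiomK e). Qed.

Lemma ecast_to_degree N k (e : k = N) (a : tpow T k) :
  ecast n (tpow T n) e a = to_degree N a.
Proof. by case: N / e; rewrite to_degree_id. Qed.

Lemma to_degree_neq N k (a : tpow T k) : k != N -> to_degree N a = 0.
Proof. by rewrite /to_degree; case: eqP. Qed.

Lemma to_degree_word N k s : k = N -> to_degree N (word k s) = word N s.
Proof. by move=> <-; rewrite to_degree_id. Qed.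

Lemma bounded_linear_to_degree N k : bounded_linear (@to_degree N k).
Proof.
have [<-|kN] := eqVneq k N.
  by rewrite (_ : to_degree k (k := k) = id); [exact: bounded_linear_id|
     apply/funext => a; rewrite to_degree_id].
rewrite (_ : to_degree N (k := k) = fun _ => 0); first exact: bounded_linear_cst0.
by apply/funext => a; rewrite to_degree_neq.
Qed.

(* The tensor product a (x) b seen in degree N; 0 if the degrees do not match. *)
Definition tmul N i j (a : tpow T i) (b : tpow T j) : tpow T N :=
  to_degree N (tens a b).

Lemma tmul_neq N i j (a : tpow T i) (b : tpow T j) :
  (i + j)%N != N -> tmul N a b = 0.
Proof. exact: to_degree_neq. Qed.

Lemma tmul_word N i j s t : size s = i -> size t = j -> (i + j)%N = N ->
  tmul N (word i s) (word j t) = word N (s ++ t).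
Proof.
move=> <- <- <-; rewrite /tmul to_degree_id tens_pure; congr tpure.
apply/funext => k; rewrite nth_cat.
by case: split_ordP => l -> //=; rewrite addKn.
Qed.

Lemma bounded_linear_tmull N i j (b : tpow T j) (W : normedModType R)
    (f : W -> tpow T i) :
  bounded_linear f -> bounded_linear (fun a => tmul N (f a) b).
Proof.
move=> fb; apply: (bounded_linear_comp (bounded_linear_to_degree _ _)).
apply: (bounded_linear_comp (g := fun a => tens a b)) fb.
split; first exact: tens_linearl.
by exists `|b| => a; rewrite mulrC norm_tens.
Qed.

Lemma bounded_linear_tmulr N i j (a : tpow T i) (W : normedModType R)
    (f : W -> tpow T j) :
  bounded_linear f -> bounded_linear (fun b => tmul N a (f b)).
Proof.
move=> fb; apply: (bounded_linear_comp (bounded_linear_to_degree _ _)).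
apply: (bounded_linear_comp (g := fun b => tens a b)) fb.
split; first exact: tens_linearr.
by exists `|a| => b; rewrite norm_tens.
Qed.

Lemma bounded_linear_tperm n (s : 'S_n) (W : normedModType R)
    (f : W -> tpow T n) :
  bounded_linear f -> bounded_linear (fun a => tperm_act s (f a)).
Proof.
apply: (bounded_linear_comp (g := tperm_act s)).
split; first exact: tperm_act_linear.
by exists 1 => a; rewrite norm_tperm_act mul1r.
Qed.

Lemma bounded_linear_degree N k (W : normedModType R) (f : W -> tpow T k) :
  bounded_linear f -> bounded_linear (fun a => to_degree N (f a)).
Proof. exact/bounded_linear_comp/bounded_linear_to_degree. Qed.

Lemma tmul1l n (a : tpow T n) : tmul n (@ts_one _ _ T 0) a = a.
Proof.
have -> : @ts_one _ _ T 0 = word 0 [::].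
  by congr tpure; apply/funext => -[].
apply: (bounded_linear_ext (bounded_linear_tmulr n (word 0 [::])
  (bounded_linear_id _)) (bounded_linear_id _)) => s sn.
by rewrite tmul_word.
Qed.

Lemma tmul1r n (a : tpow T n) : tmul n a (@ts_one _ _ T 0) = a.
Proof.
have -> : @ts_one _ _ T 0 = word 0 [::].
  by congr tpure; apply/funext => -[].
apply: (bounded_linear_ext (bounded_linear_tmull n (word 0 [::])
  (bounded_linear_id _)) (bounded_linear_id _)) => s sn.
by rewrite tmul_word ?addn0// cats0.
Qed.

(** Both sides are bounded and linear in each factor; on words the claim is associativity of
    concatenation. *)
Lemma tmulA N i j k (a : tpow T i) (b : tpow T j) (c : tpow T k) :
  (i + j + k)%N = N ->
  tmul N (tmul (i + j) a b) c = tmul N a (tmul (j + k) b c).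
Proof.
move=> ijk; move: a.
apply: bounded_linear_ext => [||s ss].
- by do ![apply: bounded_linear_tmull]; exact: bounded_linear_id.
- by do ![apply: bounded_linear_tmull]; exact: bounded_linear_id.
move: b.
apply: bounded_linear_ext => [||t st].
- apply: bounded_linear_tmull; apply: bounded_linear_tmulr.
  exact: bounded_linear_id.
- apply: bounded_linear_tmulr; apply: bounded_linear_tmull.
  exact: bounded_linear_id.
move: c.
apply: bounded_linear_ext => [||u su].
- by do ![apply: bounded_linear_tmulr]; exact: bounded_linear_id.
- by do ![apply: bounded_linear_tmulr]; exact: bounded_linear_id.
by rewrite !tmul_word ?size_cat ?ss ?st ?su ?addnA// catA.
Qed.

End TensorWords.

(** * Shuffles and masks *)

Section Masks.

Fixpoint masks (N : nat) : seq (seq bool) :=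
  if N is N'.+1 then
    [seq true :: b | b <- masks N'] ++ [seq false :: b | b <- masks N']
  else [:: [::]].

Lemma masksD k l : masks (k + l) = [seq a ++ b | a <- masks k, b <- masks l].
Proof.
elim: k => [|k IH]; first by rewrite /= cats0 map_id.
rewrite addSn /= allpairs_cat !allpairs_mapl IH.
by rewrite -!map_allpairs.
Qed.

Lemma mem_masks N b : (b \in masks N) = (size b == N).
Proof.
have cons_inj c : injective (cons c : seq bool -> seq bool) by move=> ? ? [].
elim: N b => [|N IH] [|c b] //=; rewrite mem_cat.
  by apply/negP => /orP[] /mapP[].
rewrite eqSS -IH; case: c; rewrite mem_map //.
- case: (boolP (b \in _)) => //= _; apply/negP => /mapP[? _]; discriminate.
- case: (boolP (b \in _)) => //= _; rewrite ?orbT ?orbF //.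
  by apply/negP => /mapP[? _]; discriminate.
Qed.

Lemma masks_uniq N : uniq (masks N).
Proof.
have cons_inj c : injective (cons c : seq bool -> seq bool) by move=> ? ? [].
elim: N => //= N IH; rewrite cat_uniq !map_inj_uniq // IH /= andbT.
by apply/hasPn => _ /mapP[b _ ->]; apply/negP => /mapP[? _]; discriminate.
Qed.

End Masks.

Section Shuffles.
Context {n m : nat}.
Implicit Type s : 'S_(n + m).

(* Shuffles are encoded by their masks: the k-th letter of the word of s is one
   of the first n letters iff the k-th bit is set. *)
Definition shuffle_mask s : seq bool :=
  [seq (s k < n)%N | k <- enum 'I_(n + m)].

Lemma enum_ordD :
  enum 'I_(n + m) = map (@lshift n m) (enum 'I_n) ++ map (@rshift n m) (enum 'I_m).
Proof.
apply: (inj_map val_inj); rewrite val_enum_ord map_cat iotaD.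
congr (_ ++ _).
  by rewrite -val_enum_ord -[RHS](map_comp val).
transitivity (map (addn n) (map val (enum 'I_m))).
  by rewrite val_enum_ord -iotaDl addn0.
by rewrite -[LHS](map_comp (addn n)) -[RHS](map_comp val).
Qed.

Local Notation ltI := (fun i j : 'I_(n + m) => (i < j)%N).

Lemma ltI_sorted : sorted ltI (enum 'I_(n + m)).
Proof.
rewrite -(sorted_map (f := val) (e' := ltn)) val_enum_ord.
exact: iota_ltn_sorted.
Qed.

Let ltI_trans : transitive ltI.
Proof. by move=> ? ? ?; exact: ltn_trans. Qed.

Let sorted_map_enum N (f : 'I_N -> 'I_(n + m)) :
  (forall i j : 'I_N, (i < j)%N -> ltI (f i) (f j)) ->
  sorted ltI [seq f i | i <- enum 'I_N].
Proof.
move=> fi; rewrite sorted_map.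
apply: (sub_sorted (e := fun i j : 'I_N => (i < j)%N)) => //.
rewrite -(sorted_map (f := val) (e' := ltn)) val_enum_ord.
exact: iota_ltn_sorted.
Qed.

(** The map [s^-1] increases on the first [n] letters and on the last [m]. A strictly increasing
    list is determined by its members, here the positions of the set, respectively cleared, bits. *)
Lemma shuffle_positions s : is_shuffle s ->
  [seq (s^-1)%g i | i <- enum 'I_(n + m)] =
  mask (shuffle_mask s) (enum 'I_(n + m)) ++
  mask (map negb (shuffle_mask s)) (enum 'I_(n + m)).
Proof.
move=> /andP[/forallP sl /forallP sr].
rewrite /shuffle_mask -(map_comp negb) -!filter_mask.
rewrite [in LHS]enum_ordD map_cat -(map_comp _ (@lshift n m)) -(map_comp _ (@rshift n m)).
congr (_ ++ _); apply: (@irr_sorted_eq _ ltI) => //;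
  try (by move=> i; rewrite /= ltnn).
- by apply: sorted_map_enum => i j ij; have /forallP/(_ j)/implyP := sl i; apply.
- by apply: sorted_filter => //; exact: ltI_sorted.
- move=> k; rewrite mem_filter mem_enum andbT; apply/mapP/idP.
    by case=> i _ ->; rewrite /= permKV /= ltn_ord.
  move=> kn; exists (Ordinal kn); rewrite ?mem_enum//=.
  by apply: (@perm_inj _ s); rewrite permKV; apply: val_inj.
- by apply: sorted_map_enum => i j ij; have /forallP/(_ j)/implyP := sr i; apply.
- by apply: sorted_filter => //; exact: ltI_sorted.
- move=> k; rewrite mem_filter mem_enum andbT /=; apply/mapP/idP.
    by case=> i _ ->; rewrite /= permKV /= -leqNgt leq_addr.
  rewrite -leqNgt => kn; have km : (s k - n < m)%N.
    by rewrite ltn_subLR.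
  exists (Ordinal km); rewrite ?mem_enum//=.
  by apply: (@perm_inj _ s); rewrite permKV; apply: val_inj; rewrite /= subnKC.
Qed.

Lemma size_shuffle_mask s : size (shuffle_mask s) = (n + m)%N.
Proof. by rewrite size_map size_enum_ord. Qed.

Lemma count_shuffle_mask s : count id (shuffle_mask s) = n.
Proof.
rewrite count_map -(count_map s (fun k : 'I_(n + m) => (k < n)%N)).
have /seq.permP -> : perm_eq (map s (enum 'I_(n + m))) (enum 'I_(n + m)).
  apply: uniq_perm; rewrite ?(map_inj_uniq perm_inj) ?enum_uniq// => k.
  rewrite mem_enum; apply/mapP; exists ((s^-1)%g k); rewrite ?mem_enum//.
  by rewrite permKV.
rewrite enum_ordD count_cat !count_map.
have /eq_count -> : preim (@lshift n m) (fun k : 'I_(n + m) => (k < n)%N) =1 predT.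
  by move=> i /=; rewrite ltn_ord.
have /eq_count -> : preim (@rshift n m) (fun k : 'I_(n + m) => (k < n)%N) =1 pred0.
  by move=> i /=; rewrite ltnNge leq_addr.
by rewrite count_predT count_pred0 -enumT size_enum_ord addn0.
Qed.

(** By [shuffle_positions] the mask determines [s^-1]. *)
Lemma shuffle_mask_inj :
  {in [pred s | is_shuffle s] &, injective shuffle_mask}.
Proof.
move=> s t ss st st_mask; apply: invg_inj; apply/permP => i.
have : [seq (s^-1)%g i | i <- enum 'I_(n + m)] =
       [seq (t^-1)%g i | i <- enum 'I_(n + m)].
  by rewrite !shuffle_positions// st_mask.
by move/eq_in_map => /(_ i); apply; rewrite mem_enum.
Qed.

Lemma shuffle_mask_onto b : size b = (n + m)%N -> count id b = n ->
  exists2 s, is_shuffle s & shuffle_mask s = b.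
Proof.
move=> sb cb; set e := enum 'I_(n + m).
have se : size e = (n + m)%N by rewrite size_enum_ord.
have cbn : count id (map negb b) = m.
  rewrite count_map; have := count_predC id b; rewrite cb sb => /addnI <-.
  exact: eq_count.
have s1 : size (mask b e) = n by rewrite size_mask ?se.
have s2 : size (mask (map negb b) e) = m.
  by rewrite size_mask ?cbn// se size_map. 
(* The list of values of [s^-1] for the wanted shuffle [s]: positions of the set bits first, then
   those of the cleared bits, as [shuffle_positions] dictates. *)
set l := mask b e ++ mask (map negb b) e.
have sl : size l = (n + m)%N by rewrite size_cat s1 s2.
have memb k : (k \in mask b e) = nth false b k.
  by rewrite in_mask ?enum_uniq// mem_enum index_enum_ord.
have lu : uniq l.
  rewrite cat_uniq !mask_uniq ?enum_uniq//= andbT.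
  apply/hasPn => k; rewrite memb in_mask ?enum_uniq// mem_enum index_enum_ord.
  by rewrite (nth_map false) ?sb.
have finj : injective (fun i : 'I_(n + m) => nth i l i).
  move=> i j /= ij; apply/val_inj/eqP.
  rewrite -(nth_uniq i _ _ lu) ?sl ?ltn_ord//; apply/eqP; rewrite [LHS]ij.
  by apply: set_nth_default; rewrite sl.
exists ((perm finj)^-1)%g.
- rewrite /is_shuffle invgK; apply/andP; split; apply/forallP => i;
    apply/forallP => j; apply/implyP => ij; rewrite !permE.
  + rewrite (set_nth_default (lshift m i) (lshift m j)) ?sl//.
    have lt_n (k : 'I_n) : (lshift m k < n)%N by exact: (ltn_ord k).
    rewrite !nth_cat s1 !lt_n; apply: (sorted_ltn_nth ltI_trans) => //.
    * by apply: sorted_mask => //; exact: ltI_sorted.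
    * by rewrite inE s1 lt_n.
    * by rewrite inE s1 lt_n.
  + rewrite (set_nth_default (rshift n i) (rshift n j)) ?sl//.
    have ge_n (k : 'I_m) : (rshift n k < n)%N = false by rewrite ltnNge leq_addr.
    rewrite !nth_cat s1 !ge_n !addKn; apply: (sorted_ltn_nth ltI_trans) => //.
    * by apply: sorted_mask => //; exact: ltI_sorted.
    * by rewrite inE s2 ltn_ord.
    * by rewrite inE s2 ltn_ord.
- apply: (@eq_from_nth _ false); rewrite size_map size_enum_ord ?sb// => k kN.
  rewrite (nth_map (Ordinal kN)) ?size_enum_ord//.
  have -> : nth (Ordinal kN) (enum 'I_(n + m)) k = Ordinal kN.
    by apply: val_inj; rewrite /= nth_enum_ord.
  rewrite -[RHS](memb (Ordinal kN)); set o := Ordinal kN.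
  have := permKV (perm finj) o; set i := ((perm finj)^-1)%g o.
  rewrite permE => io.
  apply/idP/idP => [i_n|].
    by rewrite -io nth_cat s1 i_n mem_nth// s1.
  apply: contraTT; rewrite -leqNgt => i_n.
  rewrite memb; have : o \in mask (map negb b) e.
    rewrite -io nth_cat s1 ltnNge i_n mem_nth// s2 ltn_subLR//.
  rewrite in_mask ?enum_uniq// mem_enum index_enum_ord.
  by rewrite (nth_map false) ?sb.
Qed.

(** Reindexing along the bijection [shuffle_mask]. Unlike a shuffle, a mask of a concatenation can
    simply be cut in two. *)
Lemma sum_shuffles (M : zmodType) (F : seq bool -> M) :
  \sum_(s : 'S_(n + m) | is_shuffle s) F (shuffle_mask s) =
  \sum_(b <- masks (n + m) | count id b == n) F b.
Proof.
rewrite -big_filter -[RHS]big_filter.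
rewrite -(big_map shuffle_mask predT F).
apply: perm_big; apply: uniq_perm.
- rewrite map_inj_in_uniq ?filter_uniq ?index_enum_uniq// => s t.
  rewrite !mem_filter => /andP[ss _] /andP[tt _]; exact: shuffle_mask_inj.
- by rewrite filter_uniq// masks_uniq.
move=> b; rewrite mem_filter mem_masks; apply/mapP/andP.
  by case=> s _ ->; rewrite count_shuffle_mask size_shuffle_mask !eqxx.
move=> [/eqP cb /eqP sb]; have [s ss sE] := shuffle_mask_onto sb cb.
by exists s; rewrite // mem_filter ss mem_index_enum.
Qed.

End Shuffles.

(** * The unshuffle coproduct *)

Section Shuffle.
Context {R : realType} {V : completeNormedModType R} (T : tensor_powers V).

Lemma word_perm (N : nat) (l : seq nat) : perm_eq l (iota 0 N) ->
  exists s : 'S_N, forall w : seq V, size w = N ->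
    tperm_act s (word T N w) = word T N [seq nth 0 w k | k <- l].
Proof.
move=> lN; have sl : size l = N by rewrite (perm_size lN) size_iota.
have lu : uniq l by rewrite (perm_uniq lN) iota_uniq.
have lt_l (i : 'I_N) : (nth 0%N l i < N)%N.
  have : nth 0%N l i \in l by rewrite mem_nth// sl.
  by rewrite (perm_mem lN) mem_iota.
have finj : injective (fun i : 'I_N => Ordinal (lt_l i)).
  move=> i j [] /eqP; rewrite nth_uniq ?sl// => /eqP; exact: val_inj.
exists (perm finj) => w wN; rewrite tperm_act_pure; congr tpure.
by apply/funext => i; rewrite permE /= (nth_map 0%N) ?sl.
Qed.

Lemma word_middle_swap (N i j i' j' : nat) : (i + j + i' + j')%N = N ->
  exists s : 'S_N, forall w1 w2 w3 w4 : seq V,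
    size w1 = i -> size w2 = j -> size w3 = i' -> size w4 = j' ->
    tperm_act s (word T N (w1 ++ w2 ++ w3 ++ w4)) =
    word T N (w1 ++ w3 ++ w2 ++ w4).
Proof.
move=> ijN.
(* The indices of the four blocks, with the second and third blocks exchanged. *)
have [|s hs] := @word_perm N
    (iota 0 i ++ iota (i + j) i' ++ iota i j ++ iota (i + j + i') j').
  by rewrite -ijN !iotaD !add0n -!catA perm_cat2l perm_catCA.
exists s => w1 w2 w3 w4 s1 s2 s3 s4; rewrite hs; last first.
  by rewrite !size_cat s1 s2 s3 s4 !addnA.
have sub (u1 u2 u3 : seq V) a b : size u1 = a -> size u2 = b ->
    [seq nth 0 (u1 ++ u2 ++ u3) k | k <- iota a b] = u2.
  move=> <- <-; apply: (@eq_from_nth _ 0); rewrite size_map size_iota// => k kb.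
  rewrite (nth_map 0%N) ?size_iota// nth_iota// nth_cat ltnNge leq_addr/= addKn.
  by rewrite nth_cat kb.
rewrite !map_cat; congr (word T N (_ ++ _ ++ _ ++ _)).
- exact: (sub [::]).
- by rewrite catA (sub (w1 ++ w2)) ?size_cat ?s1 ?s2.
- exact: sub.
- rewrite -[w4 in LHS]cats0 !catA -catA sub// !size_cat s1 s2 s3//.
Qed.

(* a1 a2 b1 b2 |-> a1 b1 a2 b2 on blocks of i, j, i', j' letters; an arbitrary
   permutation if these do not add up to N. *)
Definition middle_swap (N i j i' j' : nat) : 'S_N :=
  xget 1%g [set s : 'S_N | forall w1 w2 w3 w4 : seq V,
    size w1 = i -> size w2 = j -> size w3 = i' -> size w4 = j' ->
    tperm_act s (word T N (w1 ++ w2 ++ w3 ++ w4)) =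
    word T N (w1 ++ w3 ++ w2 ++ w4)].

Lemma middle_swapE (w1 w2 w3 w4 : seq V) (N i j i' j' : nat) :
  (i + j + i' + j')%N = N ->
  size w1 = i -> size w2 = j -> size w3 = i' -> size w4 = j' ->
  tperm_act (middle_swap N i j i' j') (word T N (w1 ++ w2 ++ w3 ++ w4)) =
  word T N (w1 ++ w3 ++ w2 ++ w4).
Proof.
move=> ijN; rewrite /middle_swap; case: xgetP => [s _|no]; first exact.
by have [s hs] := word_middle_swap ijN; case: (no s).
Qed.

(** By multilinearity and density all four factors may be taken to be words, and then this is
    [middle_swapE]. *)
Lemma middle_swap_tmul n m i i' j j' (a : tpow T i) (a' : tpow T i')
    (b : tpow T j) (b' : tpow T j') : (i + i')%N = n -> (j + j')%N = m ->
  tmul (n + m) (tmul n a a') (tmul m b b') =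
  tperm_act (middle_swap (n + m) i j i' j')
    (tmul (n + m) (tmul (i + j) a b) (tmul (i' + j') a' b')).
Proof.
move=> iin jjm; move: a; apply: bounded_linear_ext => [||w1 s1].
- by do !apply: bounded_linear_tmull; exact: bounded_linear_id.
- apply: bounded_linear_tperm; do !apply: bounded_linear_tmull.
  exact: bounded_linear_id.
move: b; apply: bounded_linear_ext => [||w2 s2].
- apply: bounded_linear_tmulr; apply: bounded_linear_tmull.
  exact: bounded_linear_id.
- apply: bounded_linear_tperm; apply: bounded_linear_tmull.
  apply: bounded_linear_tmulr; exact: bounded_linear_id.
move: a'; apply: bounded_linear_ext => [||w3 s3].
- apply: bounded_linear_tmull; apply: bounded_linear_tmulr.
  exact: bounded_linear_id.
- apply: bounded_linear_tperm; apply: bounded_linear_tmulr.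
  apply: bounded_linear_tmull; exact: bounded_linear_id.
move: b'; apply: bounded_linear_ext => [||w4 s4].
- by do !apply: bounded_linear_tmulr; exact: bounded_linear_id.
- apply: bounded_linear_tperm; do !apply: bounded_linear_tmulr.
  exact: bounded_linear_id.
have sE : (i + j + i' + j')%N = (n + m)%N by rewrite -iin -jjm addnACA addnA.
rewrite !tmul_word ?size_cat ?s1 ?s2 ?s3 ?s4 ?addnA//.
by rewrite -!catA middle_swapE.

Qed.

(* The degree (n, m) component of the coproduct dual to the shuffle product. *)
Definition unshuffle n m (a : tpow T (n + m)) : tpow T (n + m) :=
  \sum_(s : 'S_(n + m) | is_shuffle s) tperm_act (s^-1)%g a.

Lemma unshuffle_bounded n m (W : normedModType R) (f : W -> tpow T (n + m)) :
  bounded_linear f -> bounded_linear (fun a => unshuffle (f a)).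
Proof.
by move=> fb; apply: bounded_linear_big => s; exact: bounded_linear_tperm.
Qed.

(** By [shuffle_positions], the action of [s^-1] moves the letters at the set bits to the front and
    keeps the order within both groups. *)
Lemma unshuffle_word n m (w : seq V) : size w = (n + m)%N ->
  @unshuffle n m (word T (n + m) w) =
  \sum_(b <- masks (n + m) | count id b == n)
    word T (n + m) (mask b w ++ mask (map negb b) w).
Proof.
move=> wN.
rewrite -(sum_shuffles (fun b => word T (n + m) (mask b w ++ mask (map negb b) w))).
apply: eq_bigr => s ss; rewrite tperm_act_pure tpure_word; congr word.
have wE : [seq nth 0 w (val k) | k <- enum 'I_(n + m)] = w.
  by rewrite (map_comp (nth 0 w) val) val_enum_ord -wN map_nth_iota0// take_size.
have := congr1 (map (fun k : 'I_(n + m) => nth 0 w k)) (shuffle_positions ss).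
by rewrite map_cat !map_mask wE => <-; rewrite -[RHS]map_comp.
Qed.

(* The (n, m)-component of the product of two elements of T((V)) (x) T((V)). *)
Definition double_mul n m (A B : forall i j, tpow T (i + j)) : tpow T (n + m) :=
  \sum_(i < n.+1) \sum_(j < m.+1)
    tperm_act (middle_swap (n + m) i j (n - i) (m - j))
      (tmul (n + m) (A i j) (B (n - i)%N (m - j)%N)).

Lemma ts_mulE (x y : tseries T) n :
  ts_mul x y n = \sum_(i < n.+1) tmul n (x i) (y (n - i)%N).
Proof. by apply: eq_bigr => i _; rewrite ecast_to_degree. Qed.

(** Terms with [i + j] different from [n] vanish by [tmul_neq]. The ranges no longer depend on each
    other or on the degree, so sums can be exchanged freely. *)
Lemma ts_mul_sum2 (x y : tseries T) n K : (n < K)%N ->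
  ts_mul x y n = \sum_(i < K) \sum_(j < K) tmul n (x i) (y j).
Proof.
move=> nK; rewrite ts_mulE (big_ord_widen K (fun i => tmul n (x i) (y (n - i)%N)))//.
rewrite big_mkcond; apply: eq_bigr => i _; rewrite ltnS.
case: leqP => [i_n|n_i].
  have ltK : (n - i < K)%N by rewrite (leq_ltn_trans (leq_subr _ _)).
  rewrite (bigD1 (Ordinal ltK))//= big1 ?addr0// => j jn.
  rewrite tmul_neq//; apply: contra jn => /eqP ijn.
  by apply/eqP/val_inj; rewrite /= -ijn addKn.
rewrite big1// => j _; rewrite tmul_neq// gtn_eqF//.
exact: leq_trans (leq_addr _ _).
Qed.

Lemma tens_tmul n m (a : tpow T n) (b : tpow T m) : tens a b = tmul (n + m) a b.
Proof. by rewrite /tmul to_degree_id. Qed.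

Lemma tens_ts_mul (x y : tseries T) n m :
  tens (ts_mul x y n) (ts_mul x y m) =
  double_mul n m (fun i j => tens (x i) (x j)) (fun i j => tens (y i) (y j)).
Proof.
rewrite tens_tmul !ts_mulE.
rewrite (bounded_linear_sum _ _ _ (bounded_linear_tmull _ _ (bounded_linear_id _))).
apply: eq_bigr => i _.
rewrite (bounded_linear_sum _ _ _ (bounded_linear_tmulr _ _ (bounded_linear_id _))).
apply: eq_bigr => j _; rewrite !tens_tmul; apply: middle_swap_tmul;
  by rewrite subnKC// -ltnS.
Qed.

(** A mask of [s ++ t] is a pair of masks [b1], [b2]. Here [i] and [j] count the set and cleared
    bits of [b1], which leaves [n - i] and [m - j] for [b2]. *)
Lemma unshuffle_tmul_word n m k l (s t : seq V) :
  size s = k -> size t = l -> (k + l)%N = (n + m)%N ->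
  @unshuffle n m (word T (n + m) (s ++ t)) =
  \sum_(i < n.+1) \sum_(j < m.+1)
    tperm_act (middle_swap (n + m) i j (n - i) (m - j))
      (tmul (n + m)
        (@unshuffle i j (to_degree (i + j) (word T k s)))
        (@unshuffle (n - i) (m - j) (to_degree _ (word T l t)))).
Proof.
move=> sk tl kl.
rewrite unshuffle_word ?size_cat ?sk ?tl//.
have -> : masks (n + m) = [seq a ++ b | a <- masks k, b <- masks l].
  by rewrite -kl masksD.
rewrite big_mkcond big_allpairs_dep /=.
pose W b1 b2 := word T (n + m)
  (mask b1 s ++ mask b2 t ++ mask (map negb b1) s ++ mask (map negb b2) t).
transitivity (\sum_(b1 <- masks k) \sum_(b2 <- masks l)
   if (count id b1 + count id b2 == n)%N then W b1 b2 else 0).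
  apply: eq_big_seq => b1; rewrite mem_masks => /eqP sb1.
  apply: eq_bigr => b2 _; rewrite count_cat /W map_cat !mask_cat ?size_map ?sb1//.
  by rewrite -catA.
(* The sums over [i] and [j] are inserted artificially: for given masks at most one pair passes the
   test, namely the two bit counts of [b1]. *)
transitivity (\sum_(i < n.+1) \sum_(j < m.+1) \sum_(b1 <- masks k)
    \sum_(b2 <- masks l)
   if [&& i + j == k, count id b1 == i & count id b2 == n - i]%N
   then W b1 b2 else 0).
  under [RHS]eq_bigr => i _.
    rewrite exchange_big; under eq_bigr => b1 _ do rewrite exchange_big; over.
  rewrite [RHS]exchange_big; apply: eq_big_seq => b1; rewrite mem_masks => /eqP sb1 /=.
  rewrite [RHS]exchange_big; apply: eq_big_seq => b2; rewrite mem_masks => /eqP sb2 /=.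
  have c1k : (count id b1 <= k)%N by rewrite -sb1 count_size.
  have c2l : (count id b2 <= l)%N by rewrite -sb2 count_size.
  case: eqP => [c12|c12]; last first.
    rewrite big1// => i _; rewrite big1// => j _.
    case: and3P => // -[_ /eqP c1 /eqP c2]; case: c12.
    by rewrite c1 c2 subnKC// -ltnS.
  have in1 : (count id b1 < n.+1)%N by rewrite ltnS -c12 leq_addr.
  have jm : (k - count id b1 < m.+1)%N.
    by rewrite ltnS leq_subLR -(leq_add2r l) kl -c12 addnAC leq_add2l.
  rewrite (bigD1 (Ordinal in1))//= [X in _ = _ + X]big1 ?addr0.
    rewrite (bigD1 (Ordinal jm))//= [X in _ = _ + X]big1 ?addr0.
      have c2E : (n - count id b1)%N = count id b2 by rewrite -c12 addKn.
      by rewrite subnKC// c2E !eqxx.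
    move=> j jk; case: and3P => // -[/eqP jE _ _]; case/eqP: jk.
    by apply: val_inj; rewrite /= -jE addKn.
  move=> i ik; rewrite big1// => j _; case: and3P => // -[_ /eqP iE _].
  by case/eqP: ik; apply: val_inj.
apply: eq_bigr => i _; apply: eq_bigr => j _.
have in_n : (i <= n)%N by rewrite -ltnS.
have jm : (j <= m)%N by rewrite -ltnS.
have [ijk|ijk] := eqVneq (i + j)%N k; last first.
  (* If [i + j] is not the degree [k] of [s], the test fails on one side and [to_degree] gives 0 on
     the other. *)
  rewrite big1; last by move=> *; rewrite big1.
  rewrite to_degree_neq 1?eq_sym//.
  rewrite (bounded_linear0 (f := @unshuffle i j)); last first.
    exact/unshuffle_bounded/bounded_linear_id.
  rewrite (bounded_linear0 (f := fun a => tperm_act _ (tmul (n + m) a _)))//.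
  apply: bounded_linear_tperm; apply: bounded_linear_tmull.
  exact: bounded_linear_id.
have ijl : ((n - i) + (m - j))%N = l.
  by apply/eqP; rewrite -(eqn_add2l k) kl -ijk addnACA !subnKC.
rewrite !to_degree_word// !unshuffle_word ?ijk ?ijl ?sk ?tl//.
rewrite (bounded_linear_sum _ _ _
   (f := fun a => tperm_act _ (tmul (n + m) a _))); last first.
  apply: bounded_linear_tperm; apply: bounded_linear_tmull.
  exact: bounded_linear_id.
rewrite [RHS]big_mkcond; apply: eq_big_seq => b1; rewrite mem_masks => /eqP sb1.
case: (eqVneq (count id b1) i) => [c1|c1]; last by rewrite big1.
rewrite (bounded_linear_sum _ _ _
   (f := fun a => tperm_act _ (tmul (n + m) _ a))); last first.
  apply: bounded_linear_tperm; apply: bounded_linear_tmulr.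
  exact: bounded_linear_id.
rewrite [RHS]big_mkcond; apply: eq_big_seq => b2; rewrite mem_masks => /eqP sb2.
case: (eqVneq (count id b2) (n - i)%N) => [c2|c2]//=.
have cneg (b : seq bool) : count id (map negb b) = (size b - count id b)%N.
  rewrite count_map -(count_predC id b) addKn; exact: eq_count.
have szs1 : size (mask b1 s) = i by rewrite size_mask ?sk.
have szs2 : size (mask (map negb b1) s) = j.
  by rewrite size_mask ?size_map ?sk// cneg sb1 c1 -ijk addKn.
have szt1 : size (mask b2 t) = (n - i)%N by rewrite size_mask ?tl.
have szt2 : size (mask (map negb b2) t) = (m - j)%N.
  by rewrite size_mask ?size_map ?tl// cneg sb2 c2 -ijl addKn.
rewrite tmul_word ?size_cat ?szs1 ?szs2 ?szt1 ?szt2//.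
(* Unshuffling [s] and [t] separately yields the blocks set, cleared, set, cleared; exchanging the
   middle two gathers the set ones in front. *)
rewrite -catA middle_swapE//.
by rewrite -[LHS]addnA ijl ijk.
Qed.

Lemma unshuffle_tmul n m k l (a : tpow T k) (b : tpow T l) :
  @unshuffle n m (tmul (n + m) a b) =
  \sum_(i < n.+1) \sum_(j < m.+1)
    tperm_act (middle_swap (n + m) i j (n - i) (m - j))
      (tmul (n + m)
        (@unshuffle i j (to_degree (i + j) a))
        (@unshuffle (n - i) (m - j) (to_degree _ b))).
Proof.
have [kl|kl] := eqVneq (k + l)%N (n + m)%N; last first.
  (* When the degrees do not match, both sides are 0: [k = i + j] and [l = (n - i) + (m - j)] cannot
     both hold. *)
  rewrite tmul_neq// (bounded_linear0 (f := @unshuffle n m)); last first.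
    exact/unshuffle_bounded/bounded_linear_id.
  rewrite big1// => i _; rewrite big1// => j _.
  have [ijk|ijk] := eqVneq k (i + j)%N; last first.
    rewrite to_degree_neq//.
    rewrite (bounded_linear0
      (f := fun a => tperm_act _ (tmul (n + m) (@unshuffle i j a) _)))//.
    apply/bounded_linear_tperm/bounded_linear_tmull/unshuffle_bounded.
    exact: bounded_linear_id.
  rewrite [to_degree _ b]to_degree_neq; last first.
    apply: contra kl => /eqP ->; rewrite ijk addnACA !subnKC//; by rewrite -ltnS.
  rewrite (bounded_linear0 
      (f := fun a => tperm_act _ (tmul (n + m) _ (@unshuffle _ _ a))))//.
  apply/bounded_linear_tperm/bounded_linear_tmulr/unshuffle_bounded.
  exact: bounded_linear_id.
move: a; apply: bounded_linear_ext => [||s ss].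
- exact/unshuffle_bounded/bounded_linear_tmull/bounded_linear_id.
- apply: bounded_linear_big => i; apply: bounded_linear_big => j.
  apply/bounded_linear_tperm/bounded_linear_tmull/unshuffle_bounded.
  exact/bounded_linear_degree/bounded_linear_id.
move: b; apply: bounded_linear_ext => [||t tt].
- exact/unshuffle_bounded/bounded_linear_tmulr/bounded_linear_id.
- apply: bounded_linear_big => i; apply: bounded_linear_big => j.
  apply/bounded_linear_tperm/bounded_linear_tmulr/unshuffle_bounded.
  exact/bounded_linear_degree/bounded_linear_id.
by rewrite tmul_word// (unshuffle_tmul_word ss tt kl).
Qed.

(** The unshuffle coproduct is an algebra morphism from T((V)). *)
Lemma unshuffle_ts_mul (x y : tseries T) n m :
  @unshuffle n m (ts_mul x y (n + m)%N) =
  double_mul n m (fun i j => @unshuffle i j (x (i + j)%N))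
                 (fun i j => @unshuffle i j (y (i + j)%N)).
Proof.
(* Each component is rewritten as a sum over all degrees with a single nonzero term, to match the
   sums over [k] and [l] that [unshuffle_tmul] leaves on the left. *)
have sum_degree (z : tseries T) i K : (i < K)%N ->
    \sum_(k < K) to_degree i (z k) = z i.
  move=> iK; rewrite (bigD1 (Ordinal iK))//= to_degree_id big1 ?addr0// => k ki.
  by rewrite to_degree_neq//; apply: contra ki => /eqP ki; apply/eqP/val_inj.
rewrite (ts_mul_sum2 _ _ (ltnSn _)).
rewrite (bounded_linear_sum _ _ _ (f := @unshuffle n m)); last first.
  exact/unshuffle_bounded/bounded_linear_id.
under eq_bigr => k _.
  rewrite (bounded_linear_sum _ _ _ (f := @unshuffle n m)); last first.
    exact/unshuffle_bounded/bounded_linear_id.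
  under eq_bigr => l _ do rewrite unshuffle_tmul.
  rewrite exchange_big; under eq_bigr => i _ do rewrite exchange_big /=.
  over.
rewrite exchange_big; apply: eq_bigr => i _.
rewrite exchange_big; apply: eq_bigr => j _ /=.
have in_n : (i <= n)%N by rewrite -ltnS.
have jm : (j <= m)%N by rewrite -ltnS.
rewrite -[in RHS](sum_degree x (i + j)%N (n + m).+1); last first.
  by rewrite ltnS leq_add.
rewrite (bounded_linear_sum _ _ _
  (f := fun a => tperm_act _ (tmul (n + m) (@unshuffle i j a) _))); last first.
  apply/bounded_linear_tperm/bounded_linear_tmull/unshuffle_bounded.
  exact: bounded_linear_id.
apply: eq_bigr => k _.
rewrite -[in RHS](sum_degree y (n - i + (m - j))%N (n + m).+1); last first.
  by rewrite ltnS leq_add// leq_subr.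
by rewrite (bounded_linear_sum _ _ _
  (f := fun a => tperm_act _ (tmul (n + m) _ (@unshuffle _ _ a))))//;
  apply/bounded_linear_tperm/bounded_linear_tmulr/unshuffle_bounded;
  exact: bounded_linear_id.
Qed.

End Shuffle.

(** * The group of group-like series *)

Section Group.
Context {R : realType} {V : completeNormedModType R} (T : tensor_powers V).
Implicit Types x y z : tseries T.

Lemma tseries_ext x y : (forall n, x n = y n) -> x = y.
Proof. exact: functional_extensionality_dep. Qed.

Lemma tmul_suml (I : Type) (r : seq I) (P : pred I) N i j
    (F : I -> tpow T i) (b : tpow T j) :
  tmul N (\sum_(k <- r | P k) F k) b = \sum_(k <- r | P k) tmul N (F k) b.
Proof.
apply: (bounded_linear_sum (f := fun a => tmul N a b)).
exact/bounded_linear_tmull/bounded_linear_id.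
Qed.

Lemma tmul_sumr (I : Type) (r : seq I) (P : pred I) N i j
    (a : tpow T i) (F : I -> tpow T j) :
  tmul N a (\sum_(k <- r | P k) F k) = \sum_(k <- r | P k) tmul N a (F k).
Proof.
apply: (bounded_linear_sum (f := fun b => tmul N a b)).
exact/bounded_linear_tmulr/bounded_linear_id.
Qed.

Lemma tmul0l N i j (b : tpow T j) : tmul N (0 : tpow T i) b = 0.
Proof.
apply: (bounded_linear0 (f := fun a => tmul N a b)).
exact/bounded_linear_tmull/bounded_linear_id.
Qed.

Lemma tmul0r N i j (a : tpow T i) : tmul N a (0 : tpow T j) = 0.
Proof.
apply: (bounded_linear0 (f := fun b => tmul N a b)).
exact/bounded_linear_tmulr/bounded_linear_id.
Qed.

(** Only the intermediate degrees [M = i + j] on the left and [M = j + k] on the right survive, and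
    [tmulA] compares these two terms. *)
Lemma tmulA_sum K N i j k (a : tpow T i) (b : tpow T j) (c : tpow T k) :
  (N < K)%N ->
  \sum_(M < K) tmul N (tmul M a b) c = \sum_(M < K) tmul N a (tmul M b c).
Proof.
move=> NK; have [ijk|ijk] := eqVneq (i + j + k)%N N.
- have ij : (i + j < K)%N by rewrite (leq_ltn_trans _ NK)// -ijk leq_addr.
  have jk : (j + k < K)%N by rewrite (leq_ltn_trans _ NK)// -ijk -addnA leq_addl.
  rewrite (bigD1 (Ordinal ij))//= big1 ?addr0; last first.
    move=> M Mij; rewrite [tmul M a b]tmul_neq ?tmul0l//.
    by apply: contra Mij => /eqP Mij; apply/eqP/val_inj.
  rewrite (bigD1 (Ordinal jk))//= big1 ?addr0; last first.
    move=> M Mij; rewrite [tmul M b c]tmul_neq ?tmul0r//.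
    by apply: contra Mij => /eqP Mij; apply/eqP/val_inj.
  exact: tmulA.
- rewrite !big1// => M _.
  + have [jk|jk] := eqVneq (j + k)%N M; last by rewrite [tmul M b c]tmul_neq ?tmul0r.
    by rewrite tmul_neq// -jk addnA.
  + have [ij|ij] := eqVneq (i + j)%N M; last by rewrite [tmul M a b]tmul_neq ?tmul0l.
    by rewrite tmul_neq// -ij.
Qed.

(** With [ts_mul_sum2] all indices share the range [N.+1]; after exchanging sums, [tmulA_sum]
    applies for fixed [i], [j], [k]. *)
Lemma ts_mulA x y z : ts_mul (ts_mul x y) z = ts_mul x (ts_mul y z).
Proof.
apply: tseries_ext => N; rewrite !(ts_mul_sum2 _ _ (ltnSn N)).
transitivity (\sum_(i < N.+1) \sum_(j < N.+1) \sum_(k < N.+1) \sum_(M < N.+1)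
   tmul N (tmul M (x i) (y j)) (z k)).
  under eq_bigr => M _.
    under eq_bigr => k _.
      rewrite (ts_mul_sum2 x y (ltn_ord M)) tmul_suml.
      under eq_bigr => i _ do rewrite tmul_suml.
      over.
    rewrite exchange_big; under eq_bigr => i _ do rewrite exchange_big.
    over.
  rewrite exchange_big; apply: eq_bigr => i _.
  rewrite exchange_big; apply: eq_bigr => j _.
  by rewrite exchange_big.
apply: eq_bigr => i _.
under [RHS]eq_bigr => M _.
  rewrite (ts_mul_sum2 y z (ltn_ord M)) tmul_sumr.
  under eq_bigr => j _ do rewrite tmul_sumr.
  over.
rewrite [RHS]exchange_big; apply: eq_bigr => j _.
rewrite [RHS]exchange_big; apply: eq_bigr => k _.
exact: tmulA_sum.
Qed.

Lemma ts_mul1 x : ts_mul (ts_one T) x = x.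
Proof.
apply: tseries_ext => n; rewrite ts_mulE big_ord_recl/= subn0 tmul1l big1 ?addr0//.
by move=> i _; rewrite tmul0l.
Qed.

Lemma ts_mulr1 x : ts_mul x (ts_one T) = x.
Proof.
apply: tseries_ext => n; rewrite ts_mulE big_ord_recr/= subnn tmul1r big1 ?add0r//.
move=> i _; have : (0 < n - i)%N by rewrite subn_gt0.
by case: (n - i)%N => // k _; rewrite tmul0r.
Qed.

Lemma ts_mul0 x y : x 0%N = ts_one T 0 -> ts_mul x y 0%N = y 0%N.
Proof. by move=> x0; rewrite ts_mulE big_ord1 /= x0 subnn tmul1l. Qed.

(* Newton-like correction: the N-th step annihilates the degree N.+1 of
   x * y - 1 without changing the lower degrees. *)
Fixpoint right_inv_approx x (N : nat) : tseries T :=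
  if N is N'.+1 then
    let y := right_inv_approx x N' in
    fun k => y k - to_degree k (ts_mul x y N)
  else ts_one T.

Lemma right_inv_approx_stable x N k : (k <= N)%N ->
  right_inv_approx x N k = right_inv_approx x k k.
Proof.
elim: N => [|N IH]; first by rewrite leqn0 => /eqP ->.
rewrite leq_eqVlt => /predU1P[->//|]; rewrite ltnS => kN.
by rewrite /= to_degree_neq ?subr0 ?IH// gtn_eqF.
Qed.

Lemma right_inv_approxE x N n : x 0%N = ts_one T 0 -> (n <= N)%N ->
  ts_mul x (right_inv_approx x N) n = ts_one T n.
Proof.
move=> x0; elim: N n => [|N IH] n.
  by rewrite leqn0 => /eqP ->; rewrite ts_mul0.
set y := right_inv_approx x N.
rewrite leq_eqVlt => /predU1P[->|]; last first.
  rewrite ltnS => nN; rewrite -(IH _ nN) !ts_mulE; apply: eq_bigr => i _.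
  congr tmul; rewrite /= to_degree_neq ?subr0// gtn_eqF// ltnS.
  by rewrite (leq_trans (leq_subr _ _)).
(* In degree [N.+1] the correction enters only through the term with [x 0], which is 1, so exactly
   the old value of the product is subtracted. *)
rewrite ts_mulE big_ord_recl/= subn0 x0 tmul1l to_degree_id.
rewrite [X in _ - X]ts_mulE [X in _ - X]big_ord_recl/= subn0 x0 tmul1l.
rewrite opprD addrA subrr sub0r addrC; apply/eqP; rewrite subr_eq0; apply/eqP.
apply: eq_bigr => i _; congr tmul; rewrite to_degree_neq ?subr0// gtn_eqF//.
by rewrite /bump leq0n add1n subSS ltnS leq_subr.
Qed.

Lemma ts_right_inv x : x 0%N = ts_one T 0 ->
  exists2 y : tseries T, y 0%N = ts_one T 0 & ts_mul x y = ts_one T.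
Proof.
(* Degree [n] no longer changes after the [n]-th approximation. *)
move=> x0; exists (fun n => right_inv_approx x n n) => //.
apply: tseries_ext => n; rewrite -(right_inv_approxE x0 (leqnn n)) !ts_mulE.
apply: eq_bigr => i _; congr tmul.
by rewrite (right_inv_approx_stable _ (leq_subr _ _)).
Qed.

Lemma ts_invP x : x 0%N = ts_one T 0 ->
  [/\ ts_mul x (ts_inv x) = ts_one T, ts_mul (ts_inv x) x = ts_one T &
      ts_inv x 0%N = ts_one T 0].
Proof.
move=> x0; have [y y0 xy] := ts_right_inv x0.
(* The right inverse [z] of [y] equals [x] by associativity, so [y] is a two-sided inverse and the
   choice in [ts_inv] succeeds. *)
have [z z0 yz] := ts_right_inv y0.
have zx : z = x by rewrite -[z]ts_mul1 -xy ts_mulA yz ts_mulr1.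
suff [h1 h2] : ts_mul x (ts_inv x) = ts_one T /\ ts_mul (ts_inv x) x = ts_one T.
  by split=> //; rewrite -(ts_mul0 (ts_inv x) x0) h1.
rewrite /ts_inv; case: xgetP => [w _ []//|no].
by case: (no y); split=> //; rewrite -zx.
Qed.

Lemma group_like_mul x y : group_like x -> group_like y -> group_like (ts_mul x y).
Proof.
move=> [x0 xsh] [y0 ysh]; split; first by rewrite ts_mul0.
move=> n m; rewrite tens_ts_mul -/(unshuffle _) unshuffle_ts_mul.
by apply: eq_bigr => i _; apply: eq_bigr => j _; rewrite xsh ysh.
Qed.

(** The term [i = j = 0] is isolated: there [A] contributes the unit and the swap moves empty blocks
    only. It is the one term containing the top component [B n m]. *)
Lemma double_mul_head n m (A B : forall i j, tpow T (i + j)) :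
  A 0%N 0%N = ts_one T 0 ->
  double_mul n m A B = B n m +
    \sum_(i < n.+1) \sum_(j < m.+1 | (i + j != 0)%N)
      tperm_act (middle_swap T (n + m) i j (n - i) (m - j))
        (tmul (n + m) (A i j) (B (n - i)%N (m - j)%N)).
Proof.
move=> A0.
rewrite /double_mul.
under eq_bigr => i _ do rewrite (bigID (fun j : 'I_m.+1 => (i + j != 0)%N))/= addrC.
rewrite big_split/=; congr (_ + _).
rewrite big_ord_recl [X in _ + X]big1 ?addr0; last first.
  by move=> i _; rewrite big_pred0.
rewrite big_mkcond big_ord_recl/= big1 ?addr0//.
(* The differences [n - 0] and [m - 0] occur in types, so they are generalised before being
   replaced. *)
rewrite A0 /=; move: (n - 0)%N (m - 0)%N (subn0 n) (subn0 m) => n' m' -> ->.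
move: (B n m); apply: bounded_linear_ext => [||w sw].
- exact/bounded_linear_tperm/bounded_linear_tmulr/bounded_linear_id.
- exact: bounded_linear_id.
have -> : tpure T (fun=> 0) = word T 0 [::].
  by congr tpure; apply/funext => -[].
rewrite tmul_word//= -[X in word T _ X](cat_take_drop n).
rewrite (@middle_swapE _ _ _ [::] [::] (take n w) (drop n w))//.
  by rewrite size_takel// sw leq_addr.
by rewrite size_drop sw addKn.
Qed.

Lemma group_like_one : group_like (ts_one T).
Proof.
split=> // n m; rewrite -/(unshuffle _).
have [|] := posnP (n + m)%N; last first.
  case: n m => [|n] [|m]//= _; rewrite tens_tmul ?tmul0l ?tmul0r;
  by rewrite (bounded_linear0 (unshuffle_bounded (bounded_linear_id _))).
move/eqP; rewrite addn_eq0 => /andP[/eqP -> /eqP ->].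
rewrite tens_tmul tmul1l /=.
have -> : tpure T (fun=> 0) = word T 0 [::] by congr tpure; apply/funext => -[].
by rewrite unshuffle_word//= big_mkcond big_seq1.
Qed.

Lemma group_like_inv x : group_like x -> group_like (ts_inv x).
Proof.
move=> [x0 xsh]; have [xy yx y0] := ts_invP x0; set y := ts_inv x in xy yx y0 *.
split=> // n m; rewrite -/(unshuffle _).
have [N] := ubnP (n + m)%N; elim: N n m => // N IH n m nmN.
have := tens_ts_mul x y n m; rewrite xy (proj2 group_like_one) -/(unshuffle _).
rewrite -xy unshuffle_ts_mul.
have tens00 : tens (x 0%N) (x 0%N) = ts_one T 0.
  by rewrite x0 tens_tmul tmul1l.
rewrite !double_mul_head//; last by rewrite -tens00 xsh.
(* The hypothesis now equates two expansions of the coproduct of [x y = 1]. Outside [i = j = 0] they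
   agree by induction, since [(n - i) + (m - j)] is smaller than [n + m]; cancelling leaves the
   claim for [y]. *)
rewrite [X in _ + X = _](_ : _ = \sum_(i < n.+1) \sum_(j < m.+1 | (i + j != 0)%N)
      tperm_act (middle_swap T (n + m) i j (n - i) (m - j))
        (tmul (n + m) (tens (x i) (x j)) (tens (y (n - i)%N) (y (m - j)%N)))).
  by move/addIr.
apply: eq_bigr => i _; apply: eq_bigr => j ij; rewrite xsh IH//.
have in_n : (i <= n)%N by rewrite -ltnS.
have jm : (j <= m)%N by rewrite -ltnS.
rewrite -ltnS (leq_trans _ nmN)// ltnS.
by move: ij; rewrite -lt0n; lia.
Qed.

Lemma group_like_increment (X : R -> tseries T) s t :
  group_like (X s) -> group_like (X t) -> group_like (increment X s t).
Proof. by move=> Xs Xt; exact/group_like_mul/Xt/group_like_inv. Qed.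

(** Chen's relation: [X u] cancels against its inverse. *)
Lemma increment_mul (X : R -> tseries T) s u t : group_like (X u) ->
  ts_mul (increment X s u) (increment X u t) = increment X s t.
Proof.
move=> [Xu _]; have [XV _ _] := ts_invP Xu.
by rewrite /increment -ts_mulA [ts_mul (ts_mul _ _) (ts_inv _)]ts_mulA XV ts_mulr1.
Qed.

Lemma incrementxx (X : R -> tseries T) t : group_like (X t) ->
  increment X t t = ts_one T.
Proof. by move=> [Xt _]; have [_] := ts_invP Xt. Qed.

End Group.

(** * One-forms *)

Section LinearMaps.
Context {R : realType} {W1 W2 : normedModType R}.

Lemma bounded_linear_of_continuous (f : {linear W1 -> W2}) :
  continuous f -> bounded_linear f.
Proof.
move=> fc; split; first exact: linearP.
have /linear_boundedP fb := continuous_linear_bounded 0 (fc 0).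
have [r [_ hr]] := fb.
by exists (r + 1) => x; apply: hr; rewrite ltrDl.
Qed.

(** A sigma type rather than an existential, so that families of coefficients can be built with
    [sval]. *)
Lemma bounded_linear_pack (f : W1 -> W2) : bounded_linear f ->
  {g : {linear W1 -> W2} | g =1 f /\ continuous g}.
Proof.
move=> fb.
pose m := GRing.isLinear.Build R W1 W2 *:%R f (proj1 fb).
pose g : {linear W1 -> W2} := HB.pack f m.
exists g; split=> //; exact: continuous_of_bounded_linear.
Qed.

Lemma ler_opnorm (f : {linear W1 -> W2}) v : continuous f ->
  `|f v| <= opnorm f * `|v|.
Proof.
move=> /bounded_linear_of_continuous[_ [C fC]].
have ub : has_ubound [set `|f v| | v in [set v : W1 | `|v| <= 1]].
  exists `|C| => _ [u /= u1 <-].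
  rewrite (le_trans (fC _))// (le_trans (ler_norm _))// normrM normr_id.
  by rewrite ler_piMr.
have [->|v0] := eqVneq v 0; first by rewrite linear0 !normr0 mulr0.
have nv0 : 0 < `|v| by rewrite normr_gt0.
rewrite -ler_pdivrMr// mulrC -[`|v|^-1]ger0_norm ?invr_ge0// -normrZ -linearZ.
apply: ub_le_sup => //; exists (`|v|^-1 *: v) => //=.
by rewrite normrZ ger0_norm ?invr_ge0// mulVf// gt_eqF.
Qed.

Lemma opnorm_ge0 (f : W1 -> W2) : 0 <= opnorm f.
Proof.
have [[_ ub]|] := pselect (has_sup [set `|f v| | v in [set v : W1 | `|v| <= 1]]).
  apply: (@le_trans _ _ `|f 0|) => //; apply: ub_le_sup => //.
  by exists 0 => //=; rewrite normr0.
(* Without a least upper bound, [sup] takes the value 0. *)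
by move=> /sup_out; rewrite /opnorm => ->.
Qed.

End LinearMaps.

Section OneForms.
Context {R : realType} {V : completeNormedModType R} (T : tensor_powers V)
        {U : completeNormedModType R} (p : R).
Implicit Types (phi psi : tseries T -> U) (x b : tseries T).

Lemma represents_form_coef phi : one_form p phi -> represents p (form_coef p phi) phi.
Proof. exact: xgetPex. Qed.

Lemma form_normk_ge0 k phi : 0 <= form_normk p k phi.
Proof. exact: opnorm_ge0. Qed.

Lemma ler_form_norm k phi : (1 <= k < (Num.truncn p).+1)%N ->
  form_normk p k phi <= form_norm p phi.
Proof.
move=> kp; rewrite /form_norm.
by apply: (le_bigmax_seq 0 k predT (fun k => form_normk p k phi));
  rewrite ?mem_index_iota.
Qed.

Lemma form_norm_ge0 phi : 0 <= form_norm p phi.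
Proof. exact: bigmax_ge_id. Qed.

Lemma one_form_bound phi x : one_form p phi -> group_like x ->
  `|phi x| <= \sum_(1 <= k < (Num.truncn p).+1) form_normk p k phi * `|x k|.
Proof.
move=> /represents_form_coef[cc phiE] xG; rewrite phiE//.
rewrite (le_trans (ler_norm_sum _ _ _))//; apply: ler_sum => k _.
exact: (ler_opnorm _ (cc k)).
Qed.

Lemma one_formB phi psi : one_form p phi -> one_form p psi ->
  one_form p (phi \- psi).
Proof.
move=> [c [cc cE]] [d [dc dE]].
have cd k : bounded_linear (fun v => c k v - d k v).
  by apply: bounded_linear_sub; apply: bounded_linear_of_continuous;
    [exact: cc|exact: dc].
exists (fun k => sval (bounded_linear_pack (cd k))); split=> [k|x xG].
  by case: bounded_linear_pack => ? [].
rewrite /= cE// dE// -sumrB; apply: eq_bigr => k _.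
by have [-> _] := svalP (bounded_linear_pack (cd k)).
Qed.

(** In the expansion of [phi (b x)] the part of degree 0 in [x] equals [phi b], because [x 0] is 1;
    every other part is linear in a single component of [x]. *)
Lemma one_form_shift b phi : group_like b -> one_form p phi ->
  one_form p (form_shift b phi).
Proof.
move=> bG [c [cc cE]]; pose K := (Num.truncn p).+1.
(* The [j]-th coefficient of the shift; only the terms with [i + j = k] are nonzero. *)
pose d j (v : tpow T j) := \sum_(1 <= k < K) \sum_(i < K) c k (tmul k (b i) v).
have db j : bounded_linear (@d j).
  apply: bounded_linear_big => k; apply: bounded_linear_big => i.
  apply: (bounded_linear_comp (bounded_linear_of_continuous (cc k))).
  exact/bounded_linear_tmulr/bounded_linear_id.
exists (fun j => sval (bounded_linear_pack (db j))); split=> [k|x xG].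
  by case: bounded_linear_pack => ? [].
under [RHS]eq_bigr => j _.
  have [-> _] := svalP (bounded_linear_pack (db j)); over.
rewrite /form_shift !cE//; last exact: group_like_mul.
rewrite -sumrB exchange_big; apply: eq_big_nat => k /andP[_ kK].
rewrite (ts_mul_sum2 _ _ kK) exchange_big linear_sum -(big_mkord xpredT (fun j =>
  c k (\sum_(i < K) tmul k (b i) (x j)))) big_ltn//.
under [X in _ + X - _]eq_bigr do rewrite linear_sum.
rewrite addrAC (_ : \sum_(i < K) tmul k (b i) (x 0%N) = b k) ?subrr ?add0r//.
rewrite (bigD1 (Ordinal kK))//= (proj1 xG) tmul1r big1 ?addr0// => i ik.
rewrite tmul_neq// addn0; apply: contra ik => /eqP ik; exact/eqP/val_inj.
Qed.

End OneForms.

(** * Partitions and the sewing lemma *)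

Section Partitions.
Context {R : realType}.
Implicit Types (s t x d : R) (D E : seq R).

Lemma big_pt_cons (A : Type) (idx : A) (op : A -> A -> A) (f : R -> R -> A) s x D :
  \big[op/idx]_(k < size (x :: D)) f (pt s (x :: D) k) (pt s (x :: D) k.+1) =
  op (f s x) (\big[op/idx]_(k < size D) f (pt x D k) (pt x D k.+1)).
Proof. by rewrite big_ord_recl. Qed.

Lemma big_pt_cat (A : Type) (idx : A) (op : Monoid.law idx) (f : R -> R -> A)
    s D1 D2 :
  \big[op/idx]_(k < size (D1 ++ D2)) f (pt s (D1 ++ D2) k) (pt s (D1 ++ D2) k.+1) =
  op (\big[op/idx]_(k < size D1) f (pt s D1 k) (pt s D1 k.+1))
     (\big[op/idx]_(k < size D2) f (pt (last s D1) D2 k) (pt (last s D1) D2 k.+1)).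
Proof.
elim: D1 s => [|x D1 IH] s; first by rewrite big_ord0 Monoid.mul1m.
by rewrite cat_cons !big_pt_cons IH Monoid.mulmA.
Qed.

Lemma itv_partition_consE s t x D :
  itv_partition s t (x :: D) <-> s < x /\ itv_partition x t D.
Proof.
rewrite /itv_partition /=; split; first by move=> [/andP[-> ->] ->].
by move=> [-> [-> ->]].
Qed.

Lemma itv_partition_catE s t D1 D2 :
  itv_partition s t (D1 ++ D2) <->
  itv_partition s (last s D1) D1 /\ itv_partition (last s D1) t D2.
Proof.
rewrite /itv_partition cat_path last_cat eqxx; split.
  by move=> [/andP[-> ->] ->].
by move=> [[-> _] [-> ->]].
Qed.

Lemma itv_partition_le s t D : itv_partition s t D -> s <= t.
Proof.
elim: D s => [|y D IH] s; first by move=> [_ /= /eqP <-].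
by move=> /itv_partition_consE[sy /IH]; exact/le_trans/ltW.
Qed.

Lemma mem_itv_partition s t D x : itv_partition s t D -> x \in s :: D ->
  s <= x <= t.
Proof.
elim: D s => [|y D IH] s.
  by move=> [_ /= /eqP <-]; rewrite inE => /eqP ->; rewrite lexx.
move=> /itv_partition_consE[sy yt]; rewrite inE => /predU1P[->|].
  by rewrite lexx (le_trans (ltW sy))// (itv_partition_le yt).
by move=> /(IH _ yt)/andP[yx ->]; rewrite (le_trans (ltW sy)).
Qed.

Lemma itv_partition_refl t D : itv_partition t t D -> D = [::].
Proof.
case: D => // x D /itv_partition_consE[tx /itv_partition_le].
by rewrite leNgt tx.
Qed.

Lemma ler_sum_pt (f g : R -> R -> R) s t D : itv_partition s t D ->
  (forall a b, s <= a -> a <= b -> b <= t -> f a b <= g a b) ->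
  \sum_(k < size D) f (pt s D k) (pt s D k.+1) <=
  \sum_(k < size D) g (pt s D k) (pt s D k.+1).
Proof.
elim: D s => [|x D IH] s; first by rewrite !big_ord0.
move=> /itv_partition_consE[sx xt] fg.
rewrite (big_pt_cons 0 +%R f) (big_pt_cons 0 +%R g) lerD//.
  by apply: fg => //; [exact: ltW|exact: itv_partition_le xt].
by apply: IH => // a b xa; apply: fg; exact: le_trans (ltW sx) xa.
Qed.

Lemma mesh_cons_lt s x D d : 
  (mesh s (x :: D) < d) = (x - s < d) && (mesh x D < d).
Proof.
by rewrite /mesh (big_pt_cons 0 Num.max (fun a b => b - a)) gt_max.
Qed.

Lemma mesh_cat_lt s D1 D2 d : 0 < d ->
  (mesh s (D1 ++ D2) < d) = (mesh s D1 < d) && (mesh (last s D1) D2 < d).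
Proof.
move=> d0; elim: D1 s => [|x D1 IH] s.
  by rewrite [X in _ = (X < d) && _]/mesh big_ord0 d0.
by rewrite cat_cons !mesh_cons_lt IH andbA.
Qed.

Lemma exists_itv_partition s t d : 0 < d -> s <= t ->
  exists2 D, itv_partition s t D & mesh s D < d.
Proof.
move=> d0; have [n] : exists n : nat, t - s < n%:R * (d / 2).
  (* Number of steps of length [d / 2] that suffices; the induction peels off one step at a time. *)
  exists (Num.truncn ((t - s) / (d / 2))).+1.
  by rewrite -ltr_pdivrMr ?divr_gt0// truncnS_gt.
elim: n s => [|n IH] s tsn st.
  by move: tsn; rewrite mul0r subr_lt0 ltNge st.
have [->|tNs] := eqVneq t s.
  by exists [::]; [split=> //=|rewrite /mesh big_ord0].
have lt_st : s < t by rewrite lt_neqAle eq_sym tNs.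
have [tsd|dts] := ltP (t - s) d.
  exists [:: t]; first by apply/itv_partition_consE; split=> //; split=> /=.
  by rewrite mesh_cons_lt tsd /mesh big_ord0.
have [||D Dp Dd] := IH (s + d / 2).
- by move: tsn; rewrite -natr1 mulrDl mul1r; lra.
- by lra.
exists (s + d / 2 :: D).
  by apply/itv_partition_consE; split=> //; rewrite ltrDl divr_gt0.
by rewrite mesh_cons_lt Dd andbT; lra.
Qed.

Lemma common_refinement s t D D' :
  itv_partition s t D -> itv_partition s t D' ->
  exists E, [/\ itv_partition s t E, {subset D <= E} & {subset D' <= E}].
Proof.
move=> Dp D'p; pose E := sort <=%R (undup (D ++ D')).
have memE x : (x \in E) = (x \in D) || (x \in D').
  by rewrite mem_sort mem_undup mem_cat.
have gt_s F x : itv_partition s t F -> x \in F -> s < x <= t.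
  case=> sF lF xF; have := mem_itv_partition (conj sF lF) (x := x).
  rewrite inE xF orbT => /(_ isT)/andP[_ ->]; rewrite andbT.
  exact: (allP (lt_path_min sF)).
have gtE x : x \in E -> s < x <= t by rewrite memE => /orP[]; exact: gt_s.
have sE : path <%R s E.
  rewrite lt_path_sortedE sort_lt_sorted undup_uniq andbT.
  by apply/allP => x /gtE/andP[].
exists E; split; last 2 first.
- by move=> x xD; rewrite memE xD.
- by move=> x xD; rewrite memE xD orbT.
split=> //; rewrite eq_le; apply/andP; split.
  have : last s E \in s :: E by exact: mem_last.
  by rewrite inE => /predU1P[->|/gtE/andP[]//]; exact: itv_partition_le Dp.
have EP : itv_partition s (last s E) E by split=> //=.
have tE : t \in s :: E.
  rewrite inE memE; have := mem_last s D; rewrite (eqP (proj2 Dp)) inE.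
  by case: (t == s) => //= ->.
by have /andP[] := mem_itv_partition EP tE.
Qed.

Lemma mesh_to0_proper t : 0 <= t -> ProperFilter (mesh_to0 t).
Proof.
move=> t0; apply: filter_from_proper; last first.
  by move=> d /= d0; have [D Dp Dd] := exists_itv_partition d0 t0; exists D.
apply: filter_from_filter; first by exists 1 => /=.
move=> d e /= d0 e0; exists (Num.min d e); first by rewrite /= lt_min d0 e0.
by move=> D [Dp]; rewrite lt_min => /andP[Dd De]; split; split.
Qed.

End Partitions.

(** * Young's sewing argument for an almost additive function *)

Section Sewing.
Context {R : realType} {U : completeNormedModType R}.
Variables (theta M : R) (W : R -> R -> R) (mu : R -> R -> U).
Hypothesis theta_gt1 : 1 < theta.
Hypothesis W_ge0 : forall s t, 0 <= s -> s <= t -> t <= 1 -> 0 <= W s t.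
Hypothesis W_superadd : forall s u t, 0 <= s -> s <= u -> u <= t -> t <= 1 ->
  W s u + W u t <= W s t.
Hypothesis mu_almost_add : forall s u t, 0 <= s -> s <= u -> u <= t -> t <= 1 ->
  `|mu s t - mu s u - mu u t| <= M * W s t `^ theta.
Hypothesis M_ge0 : 0 <= M.

(** The solution [c] of [c = 2 + 2 * c * 2^-1 ^ theta], the recursion met in [sewing_bound]. *)
Definition sewing_const : R := 2 / (1 - 2 * 2^-1 `^ theta).

Lemma half_powR_lt : 2 * (2^-1 : R) `^ theta < 1.
Proof.
have : (2^-1 : R) `^ theta < 2^-1.
  rewrite -[X in _ < X]powRr1 ?invr_ge0//.
  rewrite /powR gt_eqF ?invr_gt0// ltr_expR ltr_nM2r//.
  by rewrite ln_lt0// invr_gt0 invf_lt1 ?ltr0n// ltr1n.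
lra.
Qed.

Lemma sewing_const_gt0 : 0 < sewing_const.
Proof. by rewrite divr_gt0// subr_gt0 half_powR_lt. Qed.

Lemma superadd_diag t : 0 <= t -> t <= 1 -> W t t = 0.
Proof.
move=> t0 t1; apply: le_anti; rewrite W_ge0// andbT.
by have := W_superadd t0 (lexx t) (lexx t) t1; lra.
Qed.

Lemma mu_diag t : 0 <= t -> t <= 1 -> mu t t = 0.
Proof.
move=> t0 t1; have := mu_almost_add t0 (lexx t) (lexx t) t1.
rewrite superadd_diag// powR0 ?mulr0; last by rewrite gt_eqF// (lt_trans ltr01).
by rewrite subrr sub0r normrN normr_le0 => /eqP.
Qed.

Let S (s : R) (D : seq R) : U :=
  \sum_(k < size D) mu (pt s D k) (pt s D k.+1).

Lemma W_mono s s' t' t : 0 <= s -> s <= s' -> s' <= t' -> t' <= t -> t <= 1 ->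
  W s' t' <= W s t.
Proof.
move=> s0 ss st tt t1.
have := W_superadd s0 ss (le_trans st tt) t1.
have := W_superadd (le_trans s0 ss) st tt t1.
have := W_ge0 s0 ss (le_trans (le_trans st tt) t1).
have := W_ge0 (le_trans (le_trans s0 ss) st) tt t1.
lra.
Qed.

(** Discrete crossing: [x] is the first point of [D] failing [P], or the last point of [D] if none
    fails. *)
Lemma exists_last (P : pred R) s D : P s -> D != [::] ->
  exists D1 x D2, [/\ D = D1 ++ x :: D2, P (last s D1) & D2 = [::] \/ ~~ P x].
Proof.
elim: D s => // x D IH s Ps _.
have [Px|nPx] := boolP (P x); last by exists [::], x, D; split=> //; right.
have [->|D0] := eqVneq D [::]; first by exists [::], x, [::]; split=> //; left.
have [D1 [y [D2 [-> lD yD]]]] := IH x Px D0.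
by exists (x :: D1), y, D2.
Qed.

(* The partition is cut at the interval [u, x] where W s _ crosses half of
   W s t: then W s u and W x t are both at most half of W s t, and the bound
   propagates with a constant because 2 * (1/2)^theta < 1. *)
Lemma sewing_bound s t D : 0 <= s -> t <= 1 -> itv_partition s t D ->
  `|mu s t - S s D| <= sewing_const * M * W s t `^ theta.
Proof.
have [n] := ubnP (size D); elim: n s t D => // n IH s t D sDn s0 t1 Dp.
have st := itv_partition_le Dp.
have CM0 : 0 <= sewing_const * M by rewrite mulr_ge0// ltW// sewing_const_gt0.
have [D0|D0] := eqVneq D [::].
  move: Dp; rewrite D0 => -[_ /eqP /= <-].
  rewrite /S big_ord0 subr0 mu_diag// ?(le_trans st)// normr0.
  by rewrite mulr_ge0// ?powR_ge0.
pose w := W s t; have w0 : 0 <= w by apply: W_ge0.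
have [|D1 [x [D2 [DE lD xD]]]] := @exists_last (fun u => W s u <= w / 2) s D _ D0.
  by rewrite superadd_diag ?(le_trans st)// divr_ge0.
set u := last s D1 in lD.
move: (Dp); rewrite DE => /itv_partition_catE[D1p /itv_partition_consE[ux D2p]].
have su := itv_partition_le D1p; have xt := itv_partition_le D2p.
have u0 : 0 <= u by rewrite (le_trans s0).
have x0 : 0 <= x by rewrite (le_trans u0)// ltW.
have x1 : x <= 1 by rewrite (le_trans xt).
have u1 : u <= 1 by rewrite (le_trans _ x1)// ltW.
have ut : u <= t by rewrite (le_trans (ltW ux)).
have sx : s <= x by rewrite (le_trans su)// ltW.
(* Either [x = t] and [W] vanishes, or [W s x] exceeds half of [w] and superadditivity leaves less
   than half for [W x t]. *)
have Wxt : W x t <= w / 2.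
  case: xD => [D20|]; last first.
    rewrite -ltNge => wx; have := W_superadd s0 sx xt t1; rewrite -/w; lra.
  move: D2p; rewrite D20 => -[_ /eqP /= <-]; rewrite superadd_diag// divr_ge0//.
have [sz1 sz2] : (size D1 < n)%N /\ (size D2 < n)%N.
  move: sDn; rewrite DE size_cat /= addnS ltnS => sn.
  by split; apply: leq_ltn_trans sn; rewrite ?leq_addr ?leq_addl.
have SE : S s D = S s D1 + (mu u x + S x D2).
  by rewrite /S DE big_pt_cat -/u big_pt_cons.
have half a : 0 <= a -> a <= w / 2 -> a `^ theta <= 2^-1 `^ theta * w `^ theta.
  move=> a0 aw; rewrite -powRM ?invr_ge0//; apply: ge0_ler_powR;
    rewrite ?nnegrE ?mulr_ge0 ?invr_ge0//; first by rewrite ltW// (lt_trans ltr01).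
  by rewrite mulrC.
have B1 := IH _ _ _ sz1 s0 u1 D1p.
have B2 := IH _ _ _ sz2 x0 t1 D2p.
have H1 := half _ (W_ge0 s0 su u1) lD.
have H2 := half _ (W_ge0 x0 xt t1) Wxt.
have E1 := mu_almost_add s0 su ut t1.
have E2 := mu_almost_add u0 (ltW ux) xt t1.
have E2' : M * W u t `^ theta <= M * w `^ theta.
  rewrite ler_wpM2l//; apply: ge0_ler_powR; rewrite ?nnegrE//.
  - by rewrite ltW// (lt_trans ltr01).
  - exact: W_ge0.
  - exact: W_mono.
rewrite -DE.
(* Two defects, at [u] and at [x], and the errors on the two shorter partitions; the interval from
   [u] to [x] itself costs nothing. *)
have -> : mu s t - S s D = (mu s t - mu s u - mu u t) +
    (mu u t - mu u x - mu x t) + (mu s u - S s D1) + (mu x t - S x D2).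
  rewrite SE -[mu u t - _ - _]addrA subrKA [_ + (mu s u - _)]addrAC subrKA.
  by rewrite [_ + (- _ - _)]addrA subrKA !opprD !addrA.
rewrite (le_trans (ler_normD _ _))//.
have N1 := ler_normD (mu s t - mu s u - mu u t + (mu u t - mu u x - mu x t))
  (mu s u - S s D1).
have N2 := ler_normD (mu s t - mu s u - mu u t) (mu u t - mu u x - mu x t).
have H1' := ler_wpM2l CM0 H1; have H2' := ler_wpM2l CM0 H2.
(* The defining equation of [sewing_const]: two defects plus two halved inductive bounds. *)
have CE : sewing_const * M * w `^ theta = 2 * (M * w `^ theta) +
    2 * (sewing_const * M * (2^-1 `^ theta * w `^ theta)).
  rewrite /sewing_const; field.
  by have := half_powR_lt; lra.
rewrite -/w in E1; rewrite CE; lra.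
Qed.

(** The refinement [E] partitions each interval of [D], and [sewing_bound] applies there. *)
Lemma sewing_refine s t D E : 0 <= s -> t <= 1 -> itv_partition s t D ->
  itv_partition s t E -> {subset D <= E} ->
  `|S s D - S s E| <= sewing_const * M *
    \sum_(k < size D) W (pt s D k) (pt s D k.+1) `^ theta.
Proof.
elim: D s E => [|x D IH] s E s0 t1.
  move=> [_ /eqP /= <-] /itv_partition_refl -> _.
  by rewrite /S !big_ord0 subrr normr0 mulr0.
move=> Dp Ep DE; have xE : x \in E by apply: DE; rewrite mem_head.
have [sx xt] := (itv_partition_consE _ _ _ _).1 Dp.
case/splitPr: xE Ep DE => E1 E2.
rewrite -cat_rcons => Ep DE.
have [E1p E2p] := (itv_partition_catE _ _ _ _).1 Ep.
rewrite last_rcons in E1p E2p.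
(* The later points of [D] lie beyond [x], hence in the part of [E] after the cut. *)
have DE2 : {subset D <= E2}.
  move=> y yD; have : y \in rcons E1 x ++ E2 by apply: DE; rewrite inE yD orbT.
  rewrite mem_cat => /orP[yE1|//].
  have : x < y by case: xt => /lt_path_min/allP/(_ _ yD).
  have /andP[_] : s <= y <= x by apply: mem_itv_partition E1p _; rewrite inE yE1 orbT.
  by rewrite leNgt => /negbTE ->.
have x0 : 0 <= x by rewrite (le_trans s0)// ltW.
have x1 : x <= 1 by rewrite (le_trans (itv_partition_le xt)).
have B1 := sewing_bound s0 x1 E1p.
have B2 := IH _ _ x0 t1 xt E2p DE2.
rewrite (big_pt_cons 0 +%R (fun a b => W a b `^ theta)) mulrDr.
rewrite /S big_pt_cons big_pt_cat last_rcons -/(S x D) -/(S s _) -/(S x E2).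
by rewrite opprD addrACA (le_trans (ler_normD _ _))// lerD.
Qed.

(** Uniform smallness near the diagonal is the form in which continuity enters the convergence of
    Riemann sums. *)
Hypothesis W_small : forall e, 0 < e -> exists2 d, 0 < d &
  forall s t, 0 <= s -> s <= t -> t <= 1 -> t - s < d -> W s t <= e.

Lemma superadd_sum s t D : 0 <= s -> t <= 1 -> itv_partition s t D ->
  \sum_(k < size D) W (pt s D k) (pt s D k.+1) <= W s t.
Proof.
elim: D s => [|x D IH] s s0 t1 Dp.
  by rewrite big_ord0 W_ge0// (itv_partition_le Dp).
have [sx xt] := (itv_partition_consE _ _ _ _).1 Dp.
have x0 : 0 <= x by rewrite (le_trans s0)// ltW.
rewrite (big_pt_cons 0 +%R W).
rewrite (le_trans _ (W_superadd s0 (ltW sx) (itv_partition_le xt) t1))//.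
by rewrite lerD2l IH.
Qed.

(** Split [W ^ theta] as [W * W ^ (theta - 1)]: the second factor is uniformly small for small mesh,
    and the first sums to at most [W 0 1]. *)
Lemma sum_powR_small e : 0 < e -> exists2 d, 0 < d &
  forall s t D, 0 <= s -> t <= 1 -> itv_partition s t D -> mesh s D < d ->
    \sum_(k < size D) W (pt s D k) (pt s D k.+1) `^ theta <= e.
Proof.
move=> e0; have W0 : 0 <= W 0 1 by apply: W_ge0.
have W10 : 0 < W 0 1 + 1 by rewrite ltr_pwDr.
(* Chosen so that [eta ^ (theta - 1) = e / (W 0 1 + 1)]. *)
pose eta := (e / (W 0 1 + 1)) `^ (theta - 1)^-1.
have eta0 : 0 < eta by rewrite powR_gt0// divr_gt0.
have [d d0 Wd] := W_small eta0; exists d => // s t D s0 t1 Dp Dd.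
have st := itv_partition_le Dp.
suff H : \sum_(k < size D) W (pt s D k) (pt s D k.+1) `^ theta <=
    e / (W 0 1 + 1) * \sum_(k < size D) W (pt s D k) (pt s D k.+1).
  rewrite (le_trans H)// -[X in _ <= X](divfK (lt0r_neq0 W10)).
  rewrite ler_wpM2l//; first by rewrite divr_ge0// ltW.
  rewrite (le_trans (superadd_sum s0 t1 Dp))//.
  rewrite (le_trans (W_mono (lexx 0) s0 st t1 (lexx 1)))//.
  by rewrite lerDl.
have theta0 : 0 < theta by exact: lt_trans theta_gt1.
elim: D s s0 st Dp Dd => [|x D IH] s s0 st Dp Dd.
  by rewrite !big_ord0 mulr0.
have [sx xt] := (itv_partition_consE _ _ _ _).1 Dp.
have x0 : 0 <= x by rewrite (le_trans s0)// ltW.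
have x1 : x <= 1 by rewrite (le_trans (itv_partition_le xt)).
move: Dd; rewrite mesh_cons_lt => /andP[xsd Dd].
rewrite (big_pt_cons 0 +%R (fun a b => W a b `^ theta)) (big_pt_cons 0 +%R W) mulrDr.
rewrite lerD ?IH ?(itv_partition_le xt)//.
have Wx0 := W_ge0 s0 (ltW sx) x1.
rewrite -mulr_powRB1// mulrC ler_wpM2r//.
rewrite (@le_trans _ _ (eta `^ (theta - 1)))//.
  apply: ge0_ler_powR; rewrite ?nnegrE ?subr_ge0//.
  - exact: ltW.
  - exact: ltW.
  - exact: (Wd _ _ s0 (ltW sx)).
rewrite -powRrM mulVf ?powRr1 ?divr_ge0//; first exact: ltW.
  exact: ltW.
by rewrite subr_eq0 gt_eqF.
Qed.

Lemma sewing_cauchy t e : 0 <= t -> t <= 1 -> 0 < e -> exists2 d, 0 < d &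
  forall D D', itv_partition 0 t D -> itv_partition 0 t D' ->
    mesh 0 D < d -> mesh 0 D' < d -> `|S 0 D - S 0 D'| < e.
Proof.
move=> t0 t1 e0.
have CM0 : 0 <= sewing_const * M by rewrite mulr_ge0// ltW// sewing_const_gt0.
have CM1 : 0 < sewing_const * M + 1 by rewrite ltr_pwDr.
(* Each of the two sums is then within [e / 3] of the sum over the common refinement. *)
pose eta := e / 3 / (sewing_const * M + 1).
have eta0 : 0 < eta by rewrite !divr_gt0.
have [d d0 hd] := sum_powR_small eta0; exists d => // D D' Dp D'p Dd D'd.
have [E [Ep DE D'E]] := common_refinement Dp D'p.
have H F : itv_partition 0 t F -> mesh 0 F < d -> {subset F <= E} ->
    `|S 0 F - S 0 E| <= e / 3.
  move=> Fp Fd FE; rewrite (le_trans (sewing_refine (lexx 0) t1 Fp Ep FE))//.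
  rewrite (le_trans (ler_wpM2l CM0 (hd _ _ _ (lexx 0) t1 Fp Fd)))//.
  rewrite /eta mulrA ler_pdivrMr// mulrC ler_wpM2l//.
    by rewrite divr_ge0// ltW.
  by rewrite lerDl.
rewrite -(subrKA (S 0 E)) (le_lt_trans (ler_normD _ _))//.
have := H _ Dp Dd DE; have := H _ D'p D'd D'E; rewrite (distrC (S 0 D')).
lra.
Qed.

Lemma sewing_cvg t : 0 <= t -> t <= 1 -> cvg (S 0 @ mesh_to0 t).
Proof.
move=> t0 t1; have FF := mesh_to0_proper t0.
apply: cauchy_cvg; apply: cauchy_exP => e e0.
have [d d0 hd] := sewing_cauchy t0 t1 e0.
have [D0 D0p D0d] := exists_itv_partition d0 t0.
exists (S 0 D0); exists d => // D [Dp Dd] /=.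
by rewrite -ball_normE /=; exact: hd.
Qed.

Lemma sewing_limP t e : 0 <= t -> t <= 1 -> 0 < e -> exists2 d, 0 < d &
  forall D, itv_partition 0 t D -> mesh 0 D < d ->
    `|lim (S 0 @ mesh_to0 t) - S 0 D| < e.
Proof.
move=> t0 t1 e0; have FF := mesh_to0_proper t0.
have /cvgrPdist_lt/(_ e e0)[d /= d0 hd] := sewing_cvg t0 t1.
by exists d => // D Dp Dd; apply: hd.
Qed.

(** Fine partitions of [[0, s]] and [[s, t]] concatenate to one of [[0, t]]; the two Riemann sums
    from 0 differ by the sum over [[s, t]], which [sewing_bound] compares with [mu s t]. *)
Lemma sewing_increment s t : 0 <= s -> s <= t -> t <= 1 ->
  `|lim (S 0 @ mesh_to0 t) - lim (S 0 @ mesh_to0 s) - mu s t| <=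
    sewing_const * M * W s t `^ theta.
Proof.
move=> s0 st t1; have t0 := le_trans s0 st; have s1 := le_trans st t1.
apply/ler_addgt0Pr => e e0; have e20 : 0 < e / 2 by rewrite divr_gt0.
have [d d0 hd] := sewing_limP s0 s1 e20.
have [d' d'0 hd'] := sewing_limP t0 t1 e20.
pose dm := Num.min d d'; have dm0 : 0 < dm by rewrite lt_min d0 d'0.
have [D1 D1p D1d] := exists_itv_partition dm0 s0.
have [D2 D2p D2d] := exists_itv_partition dm0 st.
have lD1 : last 0 D1 = s by case: D1p => _ /eqP.
have Dp : itv_partition 0 t (D1 ++ D2).
  by apply/itv_partition_catE; rewrite lD1.
have Dd : mesh 0 (D1 ++ D2) < dm by rewrite mesh_cat_lt// D1d lD1 D2d.
have B2 := sewing_bound s0 t1 D2p.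
have SE : S 0 (D1 ++ D2) = S 0 D1 + S s D2 by rewrite /S big_pt_cat lD1.
have Bs : `|lim (S 0 @ mesh_to0 s) - S 0 D1| < e / 2.
  by apply: hd => //; rewrite (lt_le_trans D1d)// ge_min lexx.
have Bt : `|lim (S 0 @ mesh_to0 t) - S 0 (D1 ++ D2)| < e / 2.
  by apply: hd' => //; rewrite (lt_le_trans Dd)// ge_min lexx orbT.
move: Bs Bt B2; set hs := lim _; set ht := lim _ => Bs Bt B2.
have -> : ht - hs - mu s t =
    (ht - S 0 (D1 ++ D2)) - (hs - S 0 D1) - (mu s t - S s D2).
  have -> : ht - S 0 (D1 ++ D2) = ht - S s D2 - S 0 D1.
    by rewrite SE [S 0 D1 + _]addrC opprD addrA.
  by rewrite !opprB subrKA [X in _ = X + _]addrAC subrKA.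
have := ler_normB (ht - S 0 (D1 ++ D2) - (hs - S 0 D1)) (mu s t - S s D2).
have := ler_normB (ht - S 0 (D1 ++ D2)) (hs - S 0 D1).
lra.
Qed.

End Sewing.

(** * Controls and p-variation *)

Section Controls.
Context {R : realType}.

(** Continuity at the diagonal, where [w] vanishes, made uniform by compactness of [[0, 1]]. *)
Lemma control_small (w : R -> R -> R) e : is_control w -> 0 < e ->
  exists2 d, 0 < d & forall s t, 0 <= s -> s <= t -> t <= 1 -> t - s < d ->
    w s t <= e.
Proof.
move=> [wc w0 wd _] e0.
pose P (d x : R) := forall t, 0 <= x -> x <= t -> t <= 1 -> t - x < d -> w x t <= e.
have /compact_near_coveringP/(_ R (0^'+) P) := @segment_compact R 0 1.
case=> [x|].
  rewrite /= in_itv /= => /andP[x0 x1].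
  have /subspace_continuousP/(_ (x, x)) := wc.
  move=> /(_ (conj x0 (conj (lexx x) x1))) /cvgrPdist_lt/(_ e e0).
  rewrite near_withinE => -[[A B] /= [Ax Bx] AB].
  have [a /= a0 Aa] := Ax; have [b /= b0 Bb] := Bx.
  (* Halved because [t] is reached from [x] in two steps, through [y], each shorter than [d]. *)
  pose d := Num.min a b / 2.
  have d0 : 0 < d by rewrite divr_gt0// lt_min a0 b0.
  have da : d + d <= a by rewrite /d -splitr ge_min lexx.
  have db : d + d <= b by rewrite /d -splitr ge_min lexx orbT.
  exists (ball x d, [set d' | d' <= d]) => /=.
    split; first exact: nbhsx_ballx.
    exact: nbhs_right_le.
  move=> [y d'] /= [xy d'd] t y0 yt t1 ytd.
  rewrite /ball /= in xy.
  have H : A y -> B t -> `|w x x - w y t| < e.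
    by move=> Ay Bt; exact: (AB (y, t) (conj Ay Bt) (conj y0 (conj yt t1))).
  rewrite wd// sub0r normrN in H.
  rewrite (le_trans (ler_norm _))// ltW//; apply: H.
    by apply: Aa; rewrite /ball_ /= (lt_le_trans xy)// (le_trans _ da)// lerDl ltW.
  apply: Bb; rewrite /ball_ /=.
  rewrite (lt_le_trans _ db)// -(subrKA y) (le_lt_trans (ler_normD _ _))//.
  rewrite ltrD// distrC ger0_norm ?subr_ge0//.
  exact: lt_le_trans d'd.
move=> d /= d0 hd; exists (d / 2); first by rewrite divr_gt0.
move=> s t s0 st t1 tsd; apply: (hd (d / 2)) => //=.
- by rewrite sub0r normrN ger0_norm ?divr_ge0 ?ltW//; lra.
- by rewrite divr_gt0.
- by rewrite in_itv /= s0 (le_trans st).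
Qed.

End Controls.

Lemma ler_fineD (R : realType) (a b c : \bar R) :
  a \is a fin_num -> b \is a fin_num -> c \is a fin_num -> (a + b <= c)%E ->
  fine a + fine b <= fine c.
Proof. by case: a b c => [a| |] [b| |] [c| |]. Qed.

Section PVariation.
Context {R : realType} {V : completeNormedModType R} (T : tensor_powers V).
Variables (p : R) (X : R -> tseries T).
Hypothesis p1 : 1 <= p.
Hypothesis X_rough : geometric_rough_path p X.

Let psum s D := (\sum_(k < size D) poweR (gdist (X (pt s D k)) (X (pt s D k.+1))) p)%E.

Lemma pvarp_ge s t D : itv_partition s t D -> (psum s D <= pvarp p X s t)%E.
Proof. by move=> Dp; apply: ereal_sup_ubound; exists D. Qed.

Lemma psum_ge0 s D : (0 <= psum s D)%E.
Proof. by apply: sume_ge0 => k _; exact: poweR_ge0. Qed.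

Lemma pvarp_ge0 s t : s <= t -> (0 <= pvarp p X s t)%E.
Proof.
move=> /(exists_itv_partition ltr01)[D Dp _].
exact: le_trans (psum_ge0 _ _) (pvarp_ge Dp).
Qed.

Lemma pvarp_fin s t : 0 <= s -> s <= t -> t <= 1 -> pvarp p X s t \is a fin_num.
Proof.
move=> s0 st t1; have [_ [w [_ hw]]] := X_rough.
by rewrite ge0_fin_numE ?pvarp_ge0// (le_lt_trans (hw _ _ s0 st t1))// ltry.
Qed.

Lemma fine_pvarp_ge0 s t : s <= t -> 0 <= fine (pvarp p X s t).
Proof. by move=> st; rewrite fine_ge0// pvarp_ge0. Qed.

Lemma pvarp_superadd s u t : 0 <= s -> s <= u -> u <= t -> t <= 1 ->
  fine (pvarp p X s u) + fine (pvarp p X u t) <= fine (pvarp p X s t).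
Proof.
move=> s0 su ut t1.
have su_fin := pvarp_fin s0 su (le_trans ut t1).
have ut_fin := pvarp_fin (le_trans s0 su) ut t1.
have st_fin := pvarp_fin s0 (le_trans su ut) t1.
apply: (ler_fineD su_fin ut_fin st_fin).
(* Moving the other summand to the right leaves one supremum to bound at a time; in the end
   partitions of the two halves are concatenated. *)
rewrite -(leeBrDr _ _ ut_fin).
apply: ge_ereal_sup => _ [D1 D1p <-]; rewrite -/(psum s D1).
have D1fin : psum s D1 \is a fin_num.
  rewrite ge0_fin_numE ?psum_ge0// (le_lt_trans (pvarp_ge D1p))//.
  by rewrite ltey_eq su_fin.
rewrite (leeBrDr _ _ ut_fin) addeC -(leeBrDr _ _ D1fin).
apply: ge_ereal_sup => _ [D2 D2p <-]; rewrite -/(psum u D2) (leeBrDr _ _ D1fin) addeC.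
have lD1 : last s D1 = u by case: D1p => _ /eqP.
have Dp : itv_partition s t (D1 ++ D2).
  by apply/itv_partition_catE; rewrite lD1.
apply: le_trans (pvarp_ge Dp).
by rewrite /psum (big_pt_cat +%E (fun a b => poweR (gdist (X a) (X b)) p)) lD1.
Qed.

(** The one-interval partition gives [d(X_s, X_t)^p <= ||X||^p], and the distance dominates each
    [|X_{s,t}^k|^(1/k)]. *)
Lemma norm_increment s t k : 0 <= s -> s <= t -> t <= 1 -> (1 <= k)%N ->
  `|increment X s t k| <= fine (pvarp p X s t) `^ (k%:R / p).
Proof.
move=> s0 st t1 k1; have [XG _] := X_rough.
have p0 : 0 < p by exact: lt_le_trans p1.
have k0 : 0 < k%:R :> R by rewrite ltr0n.
(* For [s = t] the list [[:: t]] is not a partition, but the increment is 1 and has no component of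
   degree [k >= 1]. *)
have [<-|tNs] := eqVneq s t.
  rewrite incrementxx; last by apply: XG => //; exact: le_trans t1.
  by case: k k1 {k0} => // k _; rewrite normr0 powR_ge0.
set a := `|increment X s t k|.
have ad : ((a `^ k%:R^-1)%:E <= gdist (X s) (X t))%E.
  by apply: ereal_sup_ubound; exists k.
have tp : itv_partition s t [:: t].
  by apply/itv_partition_consE; split; [rewrite lt_neqAle tNs|split=> /=].
have ap : (a `^ k%:R^-1) `^ p <= fine (pvarp p X s t).
  rewrite -lee_fin fineK ?pvarp_fin//; apply: le_trans (pvarp_ge tp).
  rewrite /psum big_ord1 -poweR_EFin; apply: gt0_ler_poweR => //.
  - exact: ltW.
  - by rewrite in_itv /= leey lee_fin powR_ge0.
  - rewrite in_itv /= leey andbT (le_trans _ ad)// lee_fin powR_ge0//.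
have {1}-> : a = ((a `^ k%:R^-1) `^ p) `^ (k%:R / p).
  have kp : k%:R^-1 * (p * (k%:R / p)) = 1 by field; rewrite !gt_eqF.
  by rewrite -!powRrM kp powRr1// /a normr_ge0.
apply: ge0_ler_powR => //; rewrite ?nnegrE ?powR_ge0//.
- by rewrite divr_ge0// ltW.
- exact: fine_pvarp_ge0.
Qed.

End PVariation.

(** * The rough integral *)

(** For [b = 0] the quotient is infinite unless [a = 0], so the finite bound forces [a = 0]. *)
Lemma ler_of_lee_div (R : realType) (a b N : R) : 0 <= a ->
  (a%:E / b%:E <= N%:E)%E -> 0 <= b -> a <= N * b.
Proof.
move=> a0 + b0; rewrite inver; case: eqVneq => [->|bN0].
  have [<-|an] := eqVneq 0 a; first by rewrite mulr0.
  by rewrite gt0_muley ?lte_fin ?lt_neqAle ?an.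
by rewrite -EFinM lee_fin ler_pdivrMr// lt_neqAle eq_sym bN0.
Qed.

(** Lowers every exponent up to [theta] to [q] at the price of one constant; the base [1 + K >= 1]
    makes powers increase with the exponent. *)
Lemma powR_le_mul (R : realType) (a K q r theta : R) : 0 <= a -> a <= K ->
  0 < q -> q <= r -> r <= theta -> a `^ r <= a `^ q * (1 + K) `^ theta.
Proof.
move=> a0 aK q0 qr rt.
have -> : a `^ r = a `^ q * a `^ (r - q).
  by rewrite -powRD addrC subrK// gt_eqF// (lt_le_trans q0).
rewrite ler_wpM2l ?powR_ge0//.
have K0 : 0 <= K by exact: le_trans aK.
apply: (@le_trans _ _ ((1 + K) `^ (r - q))).
  apply: ge0_ler_powR; rewrite ?nnegrE ?subr_ge0 ?addr_ge0//.
  by rewrite (le_trans aK)// lerDr.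
by apply: ler_powR; [rewrite lerDl|rewrite (le_trans _ rt)// gerBl ltW].
Qed.

Section SlowlyVarying.
Context {R : realType} {V : completeNormedModType R} (T : tensor_powers V)
  {U : completeNormedModType R}.
Variables (p theta : R) (X : R -> tseries T) (beta : R -> tseries T -> U)
  (w : R -> R -> R).
Hypotheses (p1 : 1 <= p) (theta_gt1 : 1 < theta).
Hypothesis X_rough : geometric_rough_path p X.
Hypothesis beta_form : one_form_along p beta.
Hypothesis w_control : is_control w.
Hypothesis beta_slow : (slow_norm p theta w X beta < +oo)%E.

Let N := fine (slow_norm p theta w X beta).
Let what s t := w s t + fine (pvarp p X s t).
Let mu s t := beta s (increment X s t).
Let P : R := (Num.truncn p)%:R.

Let p_gt0 : 0 < p. Proof. exact: lt_le_trans p1. Qed.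

Let XG t : 0 <= t -> t <= 1 -> group_like (X t).
Proof. by move=> t0 t1; exact: (proj1 X_rough). Qed.

Let XincG s t : 0 <= s -> s <= t -> t <= 1 -> group_like (increment X s t).
Proof.
by move=> s0 st t1; apply: group_like_increment; apply: XG => //;
  [exact: le_trans t1|exact: le_trans st].
Qed.

Let sup_norm := ereal_sup
  [set (form_norm p (beta t))%:E | t in [set t | (0 <= t <= 1)%R]].
Let sup_diff k := ereal_sup
  [set (form_normk p k
          (beta st.2 \- form_shift (increment X st.1 st.2) (beta st.1)))%:E
       / (w st.1 st.2 `^ (theta - k%:R / p))%:E
  | st in [set st : R * R | (0 <= st.1)%R /\ (st.1 < st.2)%R /\ (st.2 <= 1)%R]]%E.

Lemma slow_normE : [/\ 0 <= N, slow_norm p theta w X beta = N%:E,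
  (sup_norm <= N%:E)%E &
  forall k, (1 <= k < (Num.truncn p).+1)%N -> (sup_diff k <= N%:E)%E].
Proof.
have A0 : (0 <= sup_norm)%E.
  apply: (@le_trans _ _ (form_norm p (beta 0))%:E).
    by rewrite lee_fin form_norm_ge0.
  by apply: ereal_sup_ubound; exists 0 => //=; rewrite lexx ler01.
pose B := (\big[maxe/0]_(1 <= k < (Num.truncn p).+1) sup_diff k)%E.
have B0 : (0 <= B)%E by exact: bigmax_ge_id.
have NE : slow_norm p theta w X beta = N%:E.
  by rewrite fineK// ge0_fin_numE// adde_ge0.
have ABN : (sup_norm + B)%E = N%:E by rewrite -NE.
split=> //.
- by rewrite -lee_fin -NE; exact: adde_ge0.
- by rewrite -ABN leeDl.
- move=> k kp; rewrite -ABN (@le_trans _ _ B)//; last by rewrite leeDr.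
  by apply: (le_bigmax_seq 0%E k predT sup_diff); rewrite ?mem_index_iota.
Qed.

Let N_ge0 : 0 <= N. Proof. by have [] := slow_normE. Qed.

Lemma form_normk_le t k : 0 <= t -> t <= 1 -> (1 <= k < (Num.truncn p).+1)%N ->
  form_normk p k (beta t) <= N.
Proof.
move=> t0 t1 kp; apply: le_trans (ler_form_norm _ kp) _; rewrite -lee_fin.
have [_ _ + _] := slow_normE; apply: le_trans; apply: ereal_sup_ubound.
by exists t => //=; rewrite t0 t1.
Qed.

Lemma form_normk_diff_le s t k : 0 <= s -> s < t -> t <= 1 ->
  (1 <= k < (Num.truncn p).+1)%N ->
  form_normk p k (beta t \- form_shift (increment X s t) (beta s)) <=
    N * w s t `^ (theta - k%:R / p).
Proof.
move=> s0 st t1 kp; apply: ler_of_lee_div; rewrite ?powR_ge0 ?form_normk_ge0//.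
have [_ _ _ /(_ k kp)] := slow_normE; apply: le_trans.
by apply: ereal_sup_ubound; exists (s, t).
Qed.

Let degree_le k : (1 <= k < (Num.truncn p).+1)%N ->
  p^-1 <= k%:R / p <= 1.
Proof.
rewrite ltnS => /andP[k1 kp]; rewrite ler_pdivrMr// mul1r.
rewrite -[X in X <= _]mul1r ler_pM2r ?invr_gt0// ler1n k1/=.
by rewrite -truncn_ge_nat// ltW.
Qed.

Lemma w_ge0 s t : 0 <= s -> s <= t -> t <= 1 -> 0 <= w s t.
Proof. by have [_ + _ _] := w_control; apply. Qed.

Lemma what_ge0 s t : 0 <= s -> s <= t -> t <= 1 -> 0 <= what s t.
Proof. by move=> s0 st t1; rewrite addr_ge0 ?w_ge0// fine_pvarp_ge0. Qed.

Lemma what_superadd s u t : 0 <= s -> s <= u -> u <= t -> t <= 1 ->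
  what s u + what u t <= what s t.
Proof.
move=> s0 su ut t1; rewrite /what addrACA lerD//.
  by have [_ _ _] := w_control; apply.
exact: pvarp_superadd.
Qed.

Lemma what_mono s s' t' t : s <= s' -> 0 <= s -> s' <= t' -> t' <= t -> t <= 1 ->
  what s' t' <= what s t.
Proof. by move=> ss s0 st tt t1; exact: (W_mono what_ge0 what_superadd). Qed.

(** The p-variation part inherits smallness from the control that dominates it. *)
Lemma what_small e : 0 < e -> exists2 d, 0 < d &
  forall s t, 0 <= s -> s <= t -> t <= 1 -> t - s < d -> what s t <= e.
Proof.
move=> e0; have e20 : 0 < e / 2 by rewrite divr_gt0.
have [_ [w' [w'_control hw']]] := X_rough.
have [d d0 hd] := control_small w_control e20.
have [d' d'0 hd'] := control_small w'_control e20.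
exists (Num.min d d'); first by rewrite lt_min d0.
move=> s t s0 st t1; rewrite lt_min => /andP[td td'].
rewrite [e]splitr lerD ?hd//.
rewrite (le_trans _ (hd' s t s0 st t1 td'))// -lee_fin fineK; first exact: hw'.
exact: pvarp_fin.
Qed.

Lemma mu_refl t : 0 <= t -> t <= 1 -> mu t t = 0.
Proof.
move=> t0 t1; rewrite /mu incrementxx; last exact: XG.
have [c [_ cE]] := beta_form t0 t1; rewrite cE; last exact: group_like_one.
by rewrite big_nat big1// => -[|k]// _; rewrite linear0.
Qed.

Lemma mu_almost_additive s u t : 0 <= s -> s <= u -> u <= t -> t <= 1 ->
  `|mu s t - mu s u - mu u t| <= P * N * what s t `^ theta.
Proof.
move=> s0 su ut t1; have u0 := le_trans s0 su; have u1 := le_trans ut t1.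
have s1 := le_trans su u1.
(* The slow-variation bound compares distinct times only; for [s = u] the defect is 0. *)
have [<-|uNs] := eqVneq s u.
  rewrite mu_refl// subr0 subrr normr0 mulr_ge0 ?powR_ge0//.
  by rewrite mulr_ge0// ler0n.
have lt_su : s < u by rewrite lt_neqAle uNs.
pose phi := beta u \- form_shift (increment X s u) (beta s).
have phi_form : one_form p phi.
  apply: one_formB; first exact: beta_form.
  by apply: one_form_shift; [exact: XincG|exact: beta_form].
have -> : mu s t - mu s u - mu u t = - phi (increment X u t).
  by rewrite /phi /mu /form_shift /= increment_mul ?opprB//; exact: XG.
rewrite normrN (le_trans (one_form_bound phi_form (XincG u0 ut t1)))//.
rewrite -mulrA mulr_natl.
have -> : (N * what s t `^ theta) *+ Num.truncn p =
    \sum_(1 <= k < (Num.truncn p).+1) N * what s t `^ theta.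
  by rewrite sumr_const_nat subn1.
apply: ler_sum_nat => k kp.
have /andP[k1 kle1] := degree_le kp.
have w0 := what_ge0 s0 (le_trans su ut) t1.
have kp0 : 0 <= k%:R / p by rewrite divr_ge0// ltW.
(* The exponent is split between the coefficient, of order [theta - k / p], and the increment, of
   order [k / p]. *)
have -> : what s t `^ theta =
    what s t `^ (theta - k%:R / p) * what s t `^ (k%:R / p).
  by rewrite -powRD subrK// gt_eqF// (lt_trans ltr01).
rewrite mulrA ler_pM ?form_normk_ge0//.
- rewrite (le_trans (form_normk_diff_le s0 lt_su u1 kp))// ler_wpM2l//.
  apply: ge0_ler_powR; rewrite ?nnegrE//.
    by rewrite subr_ge0 (le_trans kle1)// ltW.
    exact: w_ge0.
  apply: (le_trans _ (what_mono (lexx s) s0 su ut t1)).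
  by rewrite /what lerDl fine_pvarp_ge0.
- have k1' : (1 <= k)%N by case/andP: kp.
  rewrite (le_trans (norm_increment p1 X_rough u0 ut t1 k1'))//.
  apply: ge0_ler_powR; rewrite ?nnegrE//; first exact: fine_pvarp_ge0.
  apply: (le_trans _ (what_mono su s0 ut (lexx t) t1)).
  by rewrite /what lerDr w_ge0.
Qed.

Lemma mu_bound s t : 0 <= s -> s <= t -> t <= 1 ->
  `|mu s t| <= \sum_(1 <= k < (Num.truncn p).+1) N * what s t `^ (k%:R / p).
Proof.
move=> s0 st t1; have s1 := le_trans st t1.
rewrite (le_trans (one_form_bound (beta_form s0 s1) (XincG s0 st t1)))//.
apply: ler_sum_nat => k kp; have k1' : (1 <= k)%N by case/andP: kp.
rewrite ler_pM ?form_normk_ge0//; first exact: form_normk_le.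
rewrite (le_trans (norm_increment p1 X_rough s0 st t1 k1'))//.
apply: ge0_ler_powR; rewrite ?nnegrE ?divr_ge0 ?(ltW p_gt0) ?fine_pvarp_ge0//.
  exact: what_ge0.
by rewrite /what lerDr w_ge0.
Qed.

Let h := rough_integral X beta.
Let K := what 0 1.
(** The summand 1 accounts for [mu s t], [sewing_const] for the sewing error, [P] for the number of
    degrees and the power for lowering exponents to [1 / p]. *)
Let C := (1 + sewing_const theta) * P * (1 + K) `^ theta.

Let K_ge0 : 0 <= K. Proof. by apply: what_ge0. Qed.

Let C_ge0 : 0 <= C.
Proof.
by rewrite !mulr_ge0 ?powR_ge0 ?ler0n// addr_ge0// ltW// sewing_const_gt0.
Qed.

(** By definition [rough_integral] is the limit of the Riemann sums of [mu], so [sewing_increment]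
    applies. *)
Lemma rough_integral_increment s t : 0 <= s -> s <= t -> t <= 1 ->
  `|h t - h s - mu s t| <= sewing_const theta * (P * N) * what s t `^ theta.
Proof.
have PN0 : 0 <= P * N by rewrite mulr_ge0 ?ler0n.
exact: (sewing_increment theta_gt1 what_ge0 what_superadd mu_almost_additive PN0
  what_small).
Qed.

Lemma rough_integral_holder s t : 0 <= s -> s <= t -> t <= 1 ->
  `|h t - h s| <= N * C * what s t `^ p^-1.
Proof.
move=> s0 st t1.
have w0 := what_ge0 s0 st t1.
have wK : what s t <= K by exact: (what_mono s0 (lexx 0)).
have pV0 : 0 < p^-1 by rewrite invr_gt0.
have pV1 : p^-1 <= 1 by rewrite invf_le1.
pose b := what s t `^ p^-1 * (1 + K) `^ theta.
have sc0 : 0 <= sewing_const theta by rewrite ltW// sewing_const_gt0.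
have Hmu : `|mu s t| <= P * N * b.
  rewrite (le_trans (mu_bound s0 st t1))//.
  have -> : P * N * b = \sum_(1 <= k < (Num.truncn p).+1) N * b.
    by rewrite sumr_const_nat subn1 -mulr_natl mulrA.
  apply: ler_sum_nat => k kp; rewrite ler_wpM2l//.
  have /andP[k1 kle1] := degree_le kp.
  by apply: powR_le_mul => //; rewrite (le_trans kle1)// ltW.
have Hinc : `|h t - h s - mu s t| <= sewing_const theta * (P * N) * b.
  rewrite (le_trans (rough_integral_increment s0 st t1))//.
  have CPN0 : 0 <= sewing_const theta * (P * N).
    by rewrite mulr_ge0// mulr_ge0// ler0n.
  apply: (ler_wpM2l CPN0); apply: powR_le_mul => //.
  exact: le_trans (ltW theta_gt1).
rewrite -(subrK (mu s t) (h t - h s)) (le_trans (ler_normD _ _))//.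
rewrite (le_trans (lerD Hinc Hmu))//.
by rewrite le_eqVlt; apply/orP; left; apply/eqP; rewrite /C /b; ring.
Qed.

Lemma pvar_rough_integral : (pvar p h 0 1 <= (N * (C * K `^ p^-1))%:E)%E.
Proof.
apply: ge_ereal_sup => _ [D Dp <-]; rewrite lee_fin.
have NC0 : 0 <= N * C by rewrite mulr_ge0.
have -> : N * (C * K `^ p^-1) = ((N * C) `^ p * K) `^ p^-1.
  by rewrite powRM ?powR_ge0// -powRrM divff ?gt_eqF// powRr1// mulrA.
apply: ge0_ler_powR; rewrite ?nnegrE.
- by rewrite invr_ge0 ltW.
- by rewrite sumr_ge0// => k _; rewrite powR_ge0.
- by rewrite mulr_ge0 ?powR_ge0.
(* The p-th power turns the exponent [1 / p] of [rough_integral_holder] into 1, and superadditivity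
   bounds the sum by [K]. *)
apply: (@le_trans _ _ (\sum_(k < size D) (N * C) `^ p * what (pt 0 D k) (pt 0 D k.+1))).
  apply: (ler_sum_pt (f := fun a b => `|h b - h a| `^ p)
    (g := fun a b => (N * C) `^ p * what a b) Dp) => a b a0 ab b1.
  have wab := what_ge0 a0 ab b1.
  have -> : what a b = (what a b `^ p^-1) `^ p.
    by rewrite -powRrM mulVf ?gt_eqF// powRr1.
  rewrite -powRM ?powR_ge0//.
  apply: ge0_ler_powR; rewrite ?nnegrE ?normr_ge0//; first exact: ltW.
    by rewrite mulr_ge0// powR_ge0.
  exact: rough_integral_holder.
rewrite -mulr_sumr ler_wpM2l ?powR_ge0//.
exact: (superadd_sum what_ge0 what_superadd).
Qed.

End SlowlyVarying.

Unset Implicit Arguments.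

(** Choosing [C] before the spaces, the path and the one-form, with [K] the value of [what 0 1],
    expresses that it depends only on [p], [theta] and [K]. *)
Theorem theorem27 (R : realType) (p theta K : R)
    (hp : 1 <= p) (htheta : 1 < theta) :
  exists C : R,
  forall (V : completeNormedModType R) (T : tensor_powers V)
         (U : completeNormedModType R)
         (X : R -> tseries T) (beta : R -> tseries T -> U) (w : R -> R -> R),
    geometric_rough_path p X ->
    one_form_along p beta ->
    is_control w ->
    (slow_norm p theta w X beta < +oo)%E ->
    let what := fun s t : R => w s t + fine (pvarp p X s t) in
    let h := rough_integral X beta in
    what 0 1 = K ->
    (forall s t : R, 0 <= s -> s <= t -> t <= 1 ->
       (`|h t - h s - beta s (increment X s t)|%:E
          <= C%:E * slow_norm p theta w X beta * (what s t `^ theta)%:E)%E) /\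
    (pvar p h 0 1 <= C%:E * slow_norm p theta w X beta)%E.
Proof.
pose P : R := (Num.truncn p)%:R.
(* The constants of [rough_integral_increment] and [pvar_rough_integral]; both are nonnegative, so
   their sum serves both estimates. *)
pose C1 := sewing_const theta * P.
pose C2 := (1 + sewing_const theta) * P * (1 + K) `^ theta * K `^ p^-1.
have sc0 : 0 <= sewing_const theta by rewrite ltW// sewing_const_gt0.
have C10 : 0 <= C1 by rewrite mulr_ge0 ?ler0n.
have C20 : 0 <= C2 by rewrite !mulr_ge0 ?powR_ge0 ?ler0n// addr_ge0.
exists (C1 + C2) => V T U X beta w Xr bf wc bs what h K01.
have [N0 NE _ _] := slow_normE bs.
rewrite NE; split=> [s t s0 st t1|].
  rewrite -!EFinM lee_fin.
  rewrite (le_trans (rough_integral_increment hp htheta Xr bf wc bs s0 st t1))//.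
  rewrite ler_wpM2r ?powR_ge0// mulrA ler_wpM2r//.
  by rewrite lerDl.
rewrite (le_trans (pvar_rough_integral hp htheta Xr bf wc bs))//.
rewrite -EFinM lee_fin mulrC ler_wpM2r//.
by rewrite -/(what 0 1) K01 lerDr.
Qed.
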